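(* Let $g\ge1$ and $k\ge1$ be integers. Then $$\mathcal K\circ\Phi=\mathcal M:\ \mathbb Q\mathcal D^\ell(2k)\to\mathbb Q\mathcal D^\ell(2k),$$ where $\mathcal K$ is restricted to $(H_{\mathbb Q}^{\otimes 2k})^{\mathrm{Sp}}$, and all the homomorphisms $\Phi:\mathbb Q\mathcal D^\ell(2k)\to(H_{\mathbb Q}^{\otimes 2k})^{\mathrm{Sp}}$, $\mathcal M$, and $\mathcal K:(H_{\mathbb Q}^{\otimes 2k})^{\mathrm{Sp}}\to\mathbb Q\mathcal D^\ell(2k)$ are isomorphisms if $g\ge k$. For any Young diagram $\lambda$ with $|\lambda|=k$, $$U_\lambda=\Phi(E_{\lambda'}),$$ where $\lambda'$ denotes the conjugate Young diagram of $\lambda$. Furthermore $\mathcal K(U_\lambda)=E_{\lambda'}$ for every $\lambda$ with $|\lambda|=k$ and $h(\lambda)\le g$, and the subspaces $E_{\lambda'}\subset\mathbb Q\mathcal D^\ell(2k)$ ($|\lambda|=k$) are mutually orthogonal with respect to the Euclidean metric on $\mathbb Q\mathcal D^\ell(2k)$ for which $\mathcal D^\ell(2k)$ is an orthonormal basis.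
   Context: Symplectic tensors. $H_{\mathbb Q}$ is the standard symplectic $\mathbb Q$-vector space of dimension $2g$ with skew form $\mu$ and symplectic basis $x_1,\dots,x_g,y_1,\dots,y_g$ ($\mu(x_i,y_j)=\delta_{ij}$, $\mu(x_i,x_j)=\mu(y_i,y_j)=0$); $\mathrm{Sp}=\mathrm{Sp}(2g,\mathbb Q)$; $\omega_0=\sum_{i=1}^g(x_i\otimes y_i-y_i\otimes x_i)\in(H_{\mathbb Q}^{\otimes2})^{\mathrm{Sp}}$. $\mathfrak S_{2k}$ acts on $(H_{\mathbb Q}^{\otimes 2k})^{\mathrm{Sp}}$ by permuting tensor factors. Chord diagrams. A linear chord diagram with $2k$ vertices is a partition $C=\{\{i_1,j_1\},\dots,\{i_k,j_k\}\}$ of $\{1,\dots,2k\}$ into pairs, written with $i_1<\cdots<i_k$ and $i_s<j_s$. $\mathcal D^\ell(2k)$ is the set of these and $\mathbb Q\mathcal D^\ell(2k)$ the $\mathbb Q$-vector space with this basis, with the natural $\mathfrak S_{2k}$-action. $\mathrm{sgn}\,C$ is the sign of the permutation $(1,2,\dots,2k-1,2k)\mapsto(i_1,j_1,\dots,i_k,j_k)$. For $C,D\in\mathcal D^\ell(2k)$, $\langle C,D\rangle=(-1)^{k-r}(2g)^r$, where $r$ is the number of connected components of the graph $C\cup D$ on $\{1,\dots,2k\}$. Maps. $\mathcal M(C)=\sum_{D\in\mathcal D^\ell(2k)}\langle C,D\rangle D$. $\Phi(C)=a_C$, where $a_C\in(H_{\mathbb Q}^{\otimes2k})^{\mathrm{Sp}}$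 is $\mathrm{sgn}\,C$ times the tensor obtained from $\omega_0^{\otimes k}$ by placing the $s$-th copy of $\omega_0$ in tensor positions $(i_s,j_s)$, $s=1,\dots,k$. $\mathcal K:H_{\mathbb Q}^{\otimes 2k}\to\mathbb Q\mathcal D^\ell(2k)$ is $\mathcal K(\xi)=\sum_{C}\alpha_C(\xi)\,C$, with $\alpha_C(u_1\otimes\cdots\otimes u_{2k})=\mathrm{sgn}\,C\prod_{s=1}^k\mu(u_{i_s},u_{j_s})$. Subspaces. For $\lambda=[\lambda_1\cdots\lambda_h]$ with $|\lambda|=k$, $h(\lambda)=h$, put $2\lambda=[2\lambda_1\cdots2\lambda_h]$ and $\lambda^\delta=[\lambda_1\lambda_1\lambda_2\lambda_2\cdots\lambda_h\lambda_h]$. For $|\nu|=d$, $\nu_{\mathfrak S_d}$ is the irreducible rational representation of $\mathfrak S_d$ attached to $\nu$ ($[d]_{\mathfrak S_d}$ trivial). $\mathbb Q\mathcal D^\ell(2k)$ is the multiplicity-free direct sum of irreducible submodules $E_\lambda\cong(2\lambda)_{\mathfrak S_{2k}}$, $|\lambda|=k$; and $(H_{\mathbb Q}^{\otimes2k})^{\mathrm{Sp}}$ is the multiplicity-free direct sum of irreducible submodules $U_\lambda\cong(\lambda^\delta)_{\mathfrak S_{2k}}$, $|\lambda|=k$, $h(\lambda)\le g$. Put $U_\lambda=0$ if $h(\lambda)>g$. *)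

(* Defs.v *)
From HB Require Import structures.
From mathcomp Require Import all_boot all_order all_algebra all_fingroup.

Set Implicit Arguments.
Unset Strict Implicit.
Unset Printing Implicit Defensive.

Import Order.TTheory GRing.Theory Num.Theory.
Local Open Scope ring_scope.

(** * Rational vector spaces with a finite basis *)

Notation "'Q[' I ]" := {ffun I -> rat^o} (format "'Q[' I ]") : type_scope.

Definition basis_vec (I : finType) (i : I) : Q[I] := [ffun j => (j == i)%:R].

Section LinExt.
Variables (I : finType) (V : vectType rat) (F : I -> V).

Definition lin_ext_fun (v : Q[I]) : V := \sum_i (v i : rat) *: F i.

Fact lin_ext_is_linear : linear lin_ext_fun.
Proof.
move=> a u v; rewrite /lin_ext_fun scaler_sumr -big_split /=.
by apply: eq_bigr => i _; rewrite !ffunE scalerDl scalerA.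
Qed.

HB.instance Definition _ :=
  GRing.isLinear.Build rat Q[I] V _ lin_ext_fun lin_ext_is_linear.

(* The linear map sending [basis_vec i] to [F i]. *)
Definition lin_ext : 'Hom(Q[I], V) := linfun lin_ext_fun.

Lemma lin_extE v : lin_ext v = \sum_i (v i : rat) *: F i.
Proof. by rewrite lfunE. Qed.

Lemma lin_ext_basis i : lin_ext (basis_vec i) = F i.
Proof.
rewrite lin_extE (bigD1 i) //= ffunE eqxx scale1r big1 ?addr0 // => j ne_ji.
by rewrite ffunE (negbTE ne_ji) scale0r.
Qed.

End LinExt.

(** * Representations of the symmetric group *)

(* Products in 'S_n are composed in mathcomp from left to right:
   (s * t) i = t (s i).  All three actions used below (on tensors, on chord
   diagrams, on the group algebra) are left actions for the usual composition
   of functions, that is, act (s * t) = act t \o act s. *)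
Section SymModules.
Variable n : nat.

Definition act_stable (V : vectType rat) (act : 'S_n -> 'End(V)) (W : {vspace V}) :=
  forall s v, v \in W -> act s v \in W.

Definition irreducible_submod (V : vectType rat) (act : 'S_n -> 'End(V))
    (W : {vspace V}) :=
  [/\ act_stable act W, W <> 0%VS &
      forall X : {vspace V},
        (X <= W)%VS -> act_stable act X -> X = 0%VS \/ X = W].

Definition submod_iso (V1 V2 : vectType rat)
    (act1 : 'S_n -> 'End(V1)) (W1 : {vspace V1})
    (act2 : 'S_n -> 'End(V2)) (W2 : {vspace V2}) :=
  exists f : 'Hom(V1, V2),
    [/\ (f @: W1)%VS = W2, {in W1 &, injective f} &
        forall s, {in W1, forall v, f (act1 s v) = act2 s (f v)}].

End SymModules.

(** * Young diagrams *)

(* A Young diagram is the sequence of its row lengths, nonincreasing and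
   positive; its height h(la) is [size la]. *)
Definition is_part_of (k : nat) (la : seq nat) : bool :=
  [&& sorted geq la, 0%N \notin la & sumn la == k].

(* The Young diagrams with k boxes as a finite type: they have at most k rows,
   each of length at most k. *)
Definition young (k : nat) :=
  {la : k.-bseq 'I_k.+1 | is_part_of k (map val la)}.

Definition rows (k : nat) (la : young k) : seq nat := map val (val la).

Definition conj_part (la : seq nat) : seq nat :=
  [seq count (fun r => j < r)%N la | j <- iota 0 (head 0%N la)].

Definition double_part (la : seq nat) : seq nat := [seq r.*2 | r <- la].

Definition delta_part (la : seq nat) : seq nat :=
  flatten [seq [:: r; r] | r <- la].

(** * The irreducible representation attached to a Young diagram *)

Section Specht.
Variables (d : nat) (nu : seq nat).

Definition grp_act (s : 'S_d) : 'End(Q['S_d]) :=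
  lin_ext (fun w : 'S_d => basis_vec (w * s)%g).

(* The canonical tableau lists 0, ..., d-1 row by row, so that the entry m lies
   in row [reshape_index nu m] and column [reshape_offset nu m]. *)
Definition row_stab : {set 'S_d} :=
  [set s : 'S_d | [forall m, reshape_index nu (s m) == reshape_index nu m]].

Definition col_stab : {set 'S_d} :=
  [set s : 'S_d | [forall m, reshape_offset nu (s m) == reshape_offset nu m]].

(* The Young symmetrizer: the sum of sgn(q) (p \o q) over p in the row
   stabilizer and q in the column stabilizer. *)
Definition young_symmetrizer : Q['S_d] :=
  \sum_(p in row_stab) \sum_(q in col_stab)
    ((-1) ^+ q : rat) *: basis_vec (q * p)%g.

(* The left ideal generated by the Young symmetrizer. *)
Definition specht : {vspace Q['S_d]} :=
  <<[seq grp_act s young_symmetrizer | s : 'S_d]>>%VS.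

End Specht.

(** * Linear chord diagrams *)

Definition is_chord_diagram (n : nat) (P : {set {set 'I_n}}) : bool :=
  partition P [set: 'I_n] && [forall B in P, #|B| == 2%N].

Definition chord (k : nat) := {P : {set {set 'I_(2 * k)}} | is_chord_diagram P}.

(* The pairs (i_1, j_1), ..., (i_k, j_k) with i_1 < ... < i_k and i_s < j_s; the
   list of all pairs of vertices is in lexicographic order. *)
Definition chords (k : nat) (C : chord k) : seq ('I_(2 * k) * 'I_(2 * k)) :=
  [seq p : 'I_(2 * k) * 'I_(2 * k)
     <- [seq (i, j) | i <- enum 'I_(2 * k), j <- enum 'I_(2 * k)]
     | (p.1 < p.2)%N && ([set p.1; p.2] \in val C)].

(* The word i_1 j_1 ... i_k j_k. *)
Definition chord_word (k : nat) (C : chord k) : seq 'I_(2 * k) :=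
  flatten [seq [:: p.1; p.2] | p <- chords C].

Lemma mem_chords k (C : chord k) p :
  (p \in chords C) = (p.1 < p.2)%N && ([set p.1; p.2] \in val C).
Proof.
rewrite mem_filter; case: p => i j /=.
by rewrite allpairs_f ?andbT // mem_enum.
Qed.

Lemma chords_uniq k (C : chord k) : uniq (chords C).
Proof.
apply: filter_uniq; apply: allpairs_uniq; try exact: enum_uniq.
by move=> [a b] [c e].
Qed.

Lemma chord_block k (C : chord k) (B1 B2 : {set 'I_(2 * k)}) i :
  B1 \in val C -> B2 \in val C -> i \in B1 -> i \in B2 -> B1 = B2.
Proof.
case: C => P /= /andP[/and3P[_ tP _] _] P1 P2 i1 i2.
by rewrite -(def_pblock tP P1 i1) -(def_pblock tP P2 i2).
Qed.

Lemma chords_share k (C : chord k) p q i :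
  p \in chords C -> q \in chords C ->
  i \in [:: p.1; p.2] -> i \in [:: q.1; q.2] -> p = q.
Proof.
case: p q => [a b] [c e]; rewrite !mem_chords /= => /andP[lt_ab Cab].
case/andP=> lt_ce Cce iab ice.
have Eab : [set a; b] = [set c; e].
  by apply: (chord_block Cab Cce (i := i)); rewrite !inE -?in_set2;
     [move: iab | move: ice]; rewrite !inE.
have := set21 a b; have := set22 a b; rewrite Eab !inE.
case/orP=> /eqP Eb /orP[]/eqP Ea; subst a b => //.
- by rewrite ltnn in lt_ab.
- by have := ltn_trans lt_ab lt_ce; rewrite ltnn.
by rewrite ltnn in lt_ab.
Qed.

Lemma chord_word_uniq k (C : chord k) : uniq (chord_word C).
Proof.
rewrite /chord_word.
suff flat_uniq s : uniq s -> {subset s <= chords C} ->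
    uniq (flatten [seq [:: p.1; p.2] | p <- s]).
  by apply: flat_uniq; rewrite ?chords_uniq.
elim: s => //= p s IHs /andP[ps us] sC.
have pC : p \in chords C by apply: sC; rewrite mem_head.
have notin i : i \in [:: p.1; p.2] ->
    i \notin flatten [seq [:: q.1; q.2] | q <- s].
  move=> ip; apply/flatten_mapP=> [[q qs iq]].
  have qC : q \in chords C by apply: sC; rewrite inE qs orbT.
  by move: ps; rewrite (chords_share pC qC ip iq) qs.
have sC' : {subset s <= chords C} by move=> q qs; apply: sC; rewrite inE qs orbT.
rewrite inE negb_or !notin ?inE ?eqxx ?orbT // IHs // !andbT.
by apply: contraTneq pC => Ep; rewrite mem_chords Ep ltnn.
Qed.

Lemma mem_chord_word k (C : chord k) i : i \in chord_word C.
Proof.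
have : is_chord_diagram (val C) := valP C.
case/andP=> /and3P[/eqP covC _ _] /forall_inP cardC.
have : i \in cover (val C) by rewrite covC inE.
case/bigcupP=> B CB iB; have /cards2P[a [b [ne_ab defB]]] := cardC B CB.
wlog lt_ab : a b ne_ab defB / (a < b)%N => [IH|].
  case: (ltngtP a b) => [lt_ab|lt_ba|/val_inj Eab].
  - exact: (IH a b).
  - by apply: (IH b a) => //; rewrite 1?eq_sym // setUC.
  - by rewrite Eab eqxx in ne_ab.
apply/flatten_mapP; exists (a, b); first by rewrite mem_chords lt_ab -defB.
by move: iB; rewrite defB !inE.
Qed.

Lemma size_chord_word k (C : chord k) : size (chord_word C) = (2 * k)%N.
Proof.
rewrite -(card_uniqP (chord_word_uniq C)) -[RHS]card_ord.
by apply: eq_card => i; rewrite mem_chord_word.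
Qed.

Fact chord_perm_inj k (C : chord k) :
  injective (fun m : 'I_(2 * k) => nth m (chord_word C) m).
Proof.
move=> m1 m2; rewrite (set_nth_default m2) ?size_chord_word // => /eqP.
by rewrite nth_uniq ?size_chord_word ?chord_word_uniq // => /eqP/val_inj.
Qed.

Definition chord_perm (k : nat) (C : chord k) : 'S_(2 * k) :=
  perm (@chord_perm_inj k C).

Definition sgn (k : nat) (C : chord k) : rat := (-1) ^+ chord_perm C.

(* The number of connected components of the union of C and D. *)
Definition ncomp_union (k : nat) (C D : chord k) : nat :=
  n_comp (fun i j : 'I_(2 * k) => [set i; j] \in val C :|: val D)
         [set: 'I_(2 * k)].

Definition chord_pairing (g k : nat) (C D : chord k) : rat :=
  (-1) ^+ (k - ncomp_union C D) * (2 * g)%:R ^+ ncomp_union C D.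

Fact perm_chord_subproof k (s : 'S_(2 * k)) (C : chord k) :
  is_chord_diagram [set s @: (B : {set 'I_(2 * k)}) | B in val C].
Proof.
have : is_chord_diagram (val C) := valP C.
case/andP=> /and3P[/eqP covC tC C0] /forall_inP cardC.
apply/andP; split; last first.
  apply/forall_inP=> _ /imsetP[B CB ->].
  by rewrite card_imset ?cardC //; apply: perm_inj.
apply/and3P; split.
- apply/eqP/setP=> i; rewrite !inE; apply/bigcupP.
  have : (s^-1)%g i \in cover (val C) by rewrite covC inE.
  case/bigcupP=> B CB iB; exists (s @: B); first exact: imset_f.
  by rewrite -(permKV s i) imset_f.
- apply/trivIsetP=> _ _ /imsetP[A CA ->] /imsetP[B CB ->] neAB.
  have/trivIsetP/(_ A B CA CB) := tC.
  rewrite imset_disjoint; last exact: perm_inj.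
  by apply; apply: contraNneq neAB => ->.
- apply/imsetP=> [[B CB /esym/eqP]]; rewrite imset_eq0 => /eqP B0.
  by rewrite -B0 CB in C0.
Qed.

Definition perm_chord (k : nat) (s : 'S_(2 * k)) (C : chord k) : chord k :=
  Sub _ (perm_chord_subproof s C).

Definition chord_act (k : nat) (s : 'S_(2 * k)) : 'End(Q[chord k]) :=
  lin_ext (fun C => basis_vec (perm_chord s C)).

Definition euclid (k : nat) (u v : Q[chord k]) : rat :=
  \sum_(C : chord k) (u C : rat) * (v C : rat).

(** * Symplectic tensors *)

(* [inl i] indexes x_i and [inr i] indexes y_i. *)
Definition sympl_idx (g : nat) : finType := ('I_g + 'I_g)%type.

Definition symplH (g : nat) := Q[sympl_idx g].

Definition xvec (g : nat) (i : 'I_g) : symplH g :=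
  basis_vec (inl i : sympl_idx g).
Definition yvec (g : nat) (i : 'I_g) : symplH g :=
  basis_vec (inr i : sympl_idx g).

Definition mu (g : nat) (u v : symplH g) : rat :=
  \sum_(i < g) ((u (inl i) : rat) * (v (inr i) : rat)
                - (u (inr i) : rat) * (v (inl i) : rat)).

Definition is_symplectic (g : nat) (A : 'End(symplH g)) :=
  forall u v, mu (A u) (A v) = mu u v.

(* The n-th tensor power of [symplH g], with the basis e_(h 0) \otimes ...
   \otimes e_(h (n - 1)) indexed by h, where e is the symplectic basis. *)
Definition multi_idx (g n : nat) : finType := {ffun 'I_n -> sympl_idx g}.

Definition tensor (g n : nat) := Q[multi_idx g n].

Definition pure_tensor (g n : nat) (u : 'I_n -> symplH g) : tensor g n :=
  [ffun h : multi_idx g n => \prod_i (u i (h i) : rat)].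

Definition tensor_pow (g n : nat) (A : 'End(symplH g)) : 'End(tensor g n) :=
  lin_ext (fun h : multi_idx g n =>
    pure_tensor (fun i => A (basis_vec (h i)))).

Definition Sp_invariant (g n : nat) (xi : tensor g n) :=
  forall A, is_symplectic A -> tensor_pow n A xi = xi.

(* The factor in position i is moved to position s i. *)
Definition tensor_act (g n : nat) (s : 'S_n) : 'End(tensor g n) :=
  lin_ext (fun h : multi_idx g n =>
    basis_vec ([ffun i => h ((s^-1)%g i)] : multi_idx g n)).

(* The coefficient in omega_0 of the tensor product of the basis vectors
   indexed by a and b. *)
Definition omega0 (g : nat) (a b : sympl_idx g) : rat :=
  \sum_(i < g) ((xvec i a : rat) * (yvec i b : rat)
                - (yvec i a : rat) * (xvec i b : rat)).

Definition chord_tensor (g k : nat) (C : chord k) : tensor g (2 * k) :=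
  sgn C *: [ffun h : multi_idx g (2 * k) =>
              \prod_(p <- chords C) omega0 (h p.1) (h p.2) : rat^o].

Definition chord_contraction (g k : nat) (C : chord k)
    (u : 'I_(2 * k) -> symplH g) : rat :=
  sgn C * \prod_(p <- chords C) mu (u p.1) (u p.2).

(** * The maps M, Phi and K *)

Definition M_map (g k : nat) : 'End(Q[chord k]) :=
  lin_ext (fun C : chord k =>
    \sum_(D : chord k) chord_pairing g C D *: basis_vec D).

Definition Phi_map (g k : nat) : 'Hom(Q[chord k], tensor g (2 * k)) :=
  lin_ext (fun C : chord k => chord_tensor g C).

Definition K_map (g k : nat) : 'Hom(tensor g (2 * k), Q[chord k]) :=
  lin_ext (fun h : multi_idx g (2 * k) =>
    \sum_(C : chord k)
      chord_contraction C (fun i => basis_vec (h i)) *: basis_vec C).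

(* [Sp_invariant] is a predicate and not a [{vspace _}], as it involves an
   infinite group. *)
Definition iso_between (V W : vectType rat) (P : V -> Prop) (Q : W -> Prop)
    (f : 'Hom(V, W)) :=
  [/\ forall v, P v -> Q (f v),
      forall u v, P u -> P v -> f u = f v -> u = v &
      forall w, Q w -> exists2 v, P v & f v = w].

(** * The decompositions into irreducible submodules *)

Definition E_decomposition (k : nat) (E : seq nat -> {vspace Q[chord k]}) :=
  [/\ forall la, is_part_of k la ->
        irreducible_submod (@chord_act k) (E la)
        /\ submod_iso (@chord_act k) (E la)
             (@grp_act (2 * k)) (specht (2 * k) (double_part la)),
      forall la nu, is_part_of k la -> is_part_of k nu ->
        submod_iso (@chord_act k) (E la) (@chord_act k) (E nu) -> la = nu,
      directv (\sum_(la : young k) E (rows la)) &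
      (\sum_(la : young k) E (rows la))%VS = fullv].

Definition U_decomposition (g k : nat)
    (U : seq nat -> {vspace tensor g (2 * k)}) :=
  [/\ forall la, is_part_of k la -> (size la <= g)%N ->
        irreducible_submod (@tensor_act g (2 * k)) (U la)
        /\ submod_iso (@tensor_act g (2 * k)) (U la)
             (@grp_act (2 * k)) (specht (2 * k) (delta_part la)),
      forall la nu, is_part_of k la -> is_part_of k nu ->
        (size la <= g)%N -> (size nu <= g)%N ->
        submod_iso (@tensor_act g (2 * k)) (U la)
          (@tensor_act g (2 * k)) (U nu) -> la = nu,
      directv (\sum_(la : young k | (size (rows la) <= g)%N) U (rows la)),
      forall xi, Sp_invariant xi <->
        xi \in (\sum_(la : young k | (size (rows la) <= g)%N) U (rows la))%VS &
      forall la, is_part_of k la -> (g < size la)%N -> U la = 0%VS].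

(* Main.v *)
(* In the bases of chord diagrams and of basis tensors the matrices of [Phi] and [K]
   are transposes of each other, since [omega_0] has coefficients [mu e_a e_b]. Hence
   [K o Phi] is a Gram matrix; its entries are computed by splitting off one chord
   at a time, which multiplies the pairing by [- 2g] and adds one component to the
   graph.

   [K] is injective on invariants for all [g] and [k]: invariance under
   transvections gives invariance under the Lie algebra, and an invariant all of whose
   contractions of two slots vanish is zero, because minus its squared norm (up to a
   positive factor) is then a sum of squares. With the linear independence of the
   [a_C] for [k <= g] this yields the three isomorphisms, without the first fundamental
   theorem of invariant theory.

   [Phi] and [K] are equivariant up to the sign character, and twisting by the sign
   takes the Specht module of [2 la'] to that of its transpose [la^delta]. All modules
   here carry invariant inner products, for which non-isomorphic irreducible submodules
   are orthogonal. So [K (U la)] is orthogonal to all [E nu] with [nu <> la'], hence is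
   [E la']; similarly [Phi (K (U la)) = U la]. If [h(la) > g], then [Phi (E la')] is
   orthogonal to all invariants, hence zero. *)

From HB Require Import structures.
Require Import Defs.
From mathcomp Require Import all_boot all_order all_algebra all_fingroup.
From mathcomp Require Import ring.

Set Implicit Arguments.
Unset Strict Implicit.
Unset Printing Implicit Defensive.

Import Order.TTheory GRing.Theory Num.Theory.
Local Open Scope ring_scope.

(** * Inner products and representations *)

Section Dot.
Variable I : finType.
Implicit Types u v w : Q[I].

(** The families [E] and [U] are known only through the properties that define the decompositions,
    so subspaces are identified through irreducibility, non-isomorphism and positivity of the
    standard inner products over [rat]; Schur's argument is applied to orthogonal projections. The
    sign twist comes from the skewness of [omega_0]: reversing a chord changes the sign of its
    factor and [sgn C] compensates for it, so that permuting vertices agrees with permuting tensor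
    factors up to the sign of the permutation. The factor [- 2g] of the Gram matrix has the same
    origin: its minus sign is that of a transposition, and [2g] is the sum of the squared
    coefficients of [omega_0]. On Specht modules the sign exchanges row symmetrizers and column
    antisymmetrizers, but leaves them composed in the wrong order; by positivity the two orders have
    isomorphic images. Sums over single tensor slots are formed by overwriting values of a full
    index, which multiplies them by powers of [2g]; cancelling these uses [g > 0]. *)

Definition dot u v : rat := \sum_i (u i : rat) * (v i : rat).

Lemma dotC u v : dot u v = dot v u.
Proof. by apply: eq_bigr => i _; rewrite mulrC. Qed.

Lemma dotZr a u v : dot u (a *: v) = a * dot u v.
Proof.
by rewrite /dot mulr_sumr; apply: eq_bigr => i _; rewrite ffunE mulrCA.
Qed.
Lemma dotZl a u v : dot (a *: u) v = a * dot u v.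
Proof. by rewrite dotC dotZr dotC. Qed.
Lemma dotDr u v w : dot u (v + w) = dot u v + dot u w.
Proof.
by rewrite /dot -big_split; apply: eq_bigr => i _; rewrite ffunE mulrDr.
Qed.
Lemma dotDl u v w : dot (u + v) w = dot u w + dot v w.
Proof. by rewrite dotC dotDr !(dotC w). Qed.
Lemma dotBl u v w : dot (u - v) w = dot u w - dot v w.
Proof. by rewrite -scaleN1r dotDl dotZl mulN1r. Qed.
Lemma dot0r u : dot u 0 = 0.
Proof. by rewrite -(scale0r 0) dotZr mul0r. Qed.
Lemma dot_sumr (J : Type) (r : seq J) (P : pred J) u (F : J -> Q[I]) :
  dot u (\sum_(j <- r | P j) F j) = \sum_(j <- r | P j) dot u (F j).
Proof. exact: (big_morph (dot u) (dotDr u) (dot0r u)). Qed.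

Lemma dot_eq0 v : dot v v = 0 -> v = 0.
Proof.
move/eqP; rewrite psumr_eq0 => [/allP v0|i _]; last by rewrite -expr2 sqr_ge0.
apply/ffunP=> i; rewrite ffunE.
by have := v0 i (mem_index_enum i); rewrite mulf_eq0 orbb => /eqP.
Qed.

Lemma dot_basis u i : dot u (basis_vec i) = u i.
Proof.
rewrite /dot (bigD1 i) //= ffunE eqxx mulr1 big1 ?addr0 // => j ne_ji.
by rewrite ffunE (negbTE ne_ji) mulr0.
Qed.

Lemma sum_basisE (F : I -> rat) j : (\sum_i F i *: basis_vec i) j = F j.
Proof.
rewrite sum_ffunE (bigD1 j) //= !ffunE eqxx big1 ?addr0 => [|i /negbTE ne_ij].
  by rewrite -[_ *: _]/(_ * _) mulr1.
by rewrite !ffunE eq_sym ne_ij scaler0.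
Qed.

Lemma basis_decomp v : v = \sum_i (v i : rat) *: basis_vec i.
Proof. by apply/ffunP=> j; rewrite sum_basisE. Qed.

End Dot.

Lemma lin_ext_coef (I J : finType) (F : I -> Q[J]) v j :
  lin_ext F v j = \sum_i (v i : rat) * (F i j : rat).
Proof. by rewrite lin_extE sum_ffunE; apply: eq_bigr => i _; rewrite ffunE. Qed.

Lemma lin_ext_perm (I : finType) (f f' : I -> I) :
  cancel f f' -> cancel f' f -> forall (v : Q[I]) i,
  lin_ext (fun j => basis_vec (f j)) v i = v (f' i).
Proof.
move=> fK f'K v i; rewrite lin_ext_coef (bigD1 (f' i)) //= ffunE f'K eqxx mulr1.
rewrite big1 ?addr0 // => j ne_j; rewrite ffunE.
case: eqP => [Ei|]; last by rewrite mulr0.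
by rewrite Ei fK eqxx in ne_j.
Qed.

Lemma dot_lin_ext_perm (I : finType) (f f' : I -> I) :
  cancel f f' -> cancel f' f -> forall u v : Q[I],
  dot (lin_ext (fun j => basis_vec (f j)) u) v
    = dot u (lin_ext (fun j => basis_vec (f' j)) v).
Proof.
move=> fK f'K u v; rewrite /dot (reindex f) /=; last by exists f' => i _.
by apply: eq_bigr => i _; rewrite (lin_ext_perm fK f'K) fK (lin_ext_perm f'K fK).
Qed.

Section Orthogonal.
Variable I : finType.
Implicit Types (X Y : {vspace Q[I]}) (u v : Q[I]).

Definition orthogonal_subspaces X Y := forall u v, u \in X -> v \in Y -> dot u v = 0.

(** An orthonormal basis of [Y] need not exist over [rat]. Instead [B] records the inner products
    with a basis of [Y]; positivity makes it injective on [Y], hence onto by dimension, and [p u] is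
    the vector of [Y] with the same image under [B] as [u]. *)
Lemma orthogonal_proj Y : exists p : 'End(Q[I]),
  (forall u, p u \in Y) /\ (forall u v, v \in Y -> dot (u - p u) v = 0).
Proof.
pose b := vbasis Y.
pose beta_fun v : Q['I_(\dim Y)] := [ffun i => dot (tnth b i) v : rat^o].
have beta_lin : linear beta_fun.
  by move=> a u v; apply/ffunP=> i; rewrite !ffunE dotDr dotZr.
pose betaL := GRing.isLinear.Build rat Q[I] Q['I_(\dim Y)] _ beta_fun beta_lin.
pose beta : {linear Q[I] -> Q['I_(\dim Y)]} := HB.pack beta_fun betaL.
pose B : 'Hom(Q[I], Q['I_(\dim Y)]) := linfun beta.
have orthB u : B u = 0 -> forall v, v \in Y -> dot u v = 0.
  move=> Bu v Yv; rewrite (coord_vbasis Yv) dot_sumr big1 // => i _.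
  rewrite dotZr -tnth_nth dotC.
  by move: Bu => /ffunP/(_ i); rewrite lfunE !ffunE => ->; rewrite mulr0.
have kerB : (Y :&: lker B = 0)%VS.
  apply/eqP; rewrite -subv0; apply/subvP=> v; rewrite memv_cap memv_ker memv0.
  by case/andP=> Yv /eqP Bv; apply/eqP/dot_eq0/orthB.
have imB : (B @: Y = fullv)%VS.
  apply/eqP; rewrite eqEdim subvf /= limg_dim_eq //.
  by rewrite dimvf /dim /= muln1 card_ord.
pose f := (B \o projv Y)%VF.
have limf : limg f = fullv.
  rewrite limg_comp; have -> : limg (projv Y) = Y by rewrite limg_proj.
  exact: imB.
exists (projv Y \o f^-1 \o B)%VF; split=> [u|u v Yv].
  by rewrite !comp_lfunE memv_proj.
apply: orthB Yv; apply/eqP; rewrite linearB subr_eq0; apply/eqP.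
rewrite !comp_lfunE; transitivity (f (f^-1 (B u))%VF); last by rewrite comp_lfunE.
by rewrite limg_lfunVK // limf memvf.
Qed.

End Orthogonal.

(** * Submodules, their isomorphisms and orthogonality *)

Section Submodules.
Variable n : nat.

Definition sgn_act (V : vectType rat) (act : 'S_n -> 'End(V)) (s : 'S_n) : 'End(V) :=
  ((-1) ^+ s : rat) *: act s.

Lemma sgn_actE (V : vectType rat) (act : 'S_n -> 'End(V)) s v :
  sgn_act act s v = ((-1) ^+ s : rat) *: act s v.
Proof. by rewrite scale_lfunE. Qed.

Lemma sgn_actK (V : vectType rat) (act : 'S_n -> 'End(V)) s v :
  sgn_act (sgn_act act) s v = act s v.
Proof. by rewrite !sgn_actE scalerA -expr2 sqrr_sign scale1r. Qed.

Section TwoModules.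
Variables (V1 V2 : vectType rat) (act1 : 'S_n -> 'End(V1)) (act2 : 'S_n -> 'End(V2)).
Variables (W1 : {vspace V1}) (W2 : {vspace V2}).

Lemma submod_iso_sgnr :
  submod_iso (sgn_act act1) W1 act2 W2 -> submod_iso act1 W1 (sgn_act act2) W2.
Proof.
case=> f [fW f_inj fact]; exists f; split=> // s v Wv.
by rewrite sgn_actE -fact // sgn_actE linearZ /= scalerA -expr2 sqrr_sign scale1r.
Qed.

(** An isomorphism is a linear map on the ambient space that matters only on [W1]. Precomposing with
    the projection onto [W1] gives a map [h] with image exactly [W2]; a right inverse of [h] on
    [W2], followed by the projection, inverts [f]. *)
Lemma submod_iso_sym : act_stable act1 W1 ->
  submod_iso act1 W1 act2 W2 -> submod_iso act2 W2 act1 W1.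
Proof.
move=> stW1 [f [fW f_inj fact]].
pose h := (f \o projv W1)%VF.
have limh : limg h = W2 by rewrite limg_comp -[X in (f @: X)%VS]/(limg (projv W1)) limg_proj.
pose h' := (projv W1 \o h^-1)%VF.
have h'W1 w : h' w \in W1 by rewrite comp_lfunE memv_proj.
have fh' w : w \in W2 -> f (h' w) = w.
  move=> Ww; transitivity (h ((h^-1)%VF w)); last by rewrite limg_lfunVK ?limh.
  by rewrite !comp_lfunE.
have h'f v : v \in W1 -> h' (f v) = v.
  by move=> Wv; apply: f_inj; rewrite ?fh' // -fW memv_img.
exists h'; split.
- apply/eqP; rewrite eqEsubv; apply/andP; split; apply/subvP=> v.
    by case/memv_imgP=> w _ ->.
  by move=> Wv; rewrite -(h'f v Wv) memv_img // -fW memv_img.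
- by move=> v w Wv Ww E; rewrite -(fh' v Wv) E fh'.
move=> s w Ww; apply: f_inj; rewrite ?stW1 //.
by rewrite fact // !fh' // -(fh' w Ww) -fact // -fW memv_img ?stW1.
Qed.

Lemma irreducible_iso : irreducible_submod act1 W1 ->
  submod_iso act1 W1 act2 W2 -> irreducible_submod act2 W2.
Proof.
case=> stW1 W1n0 irrW1 [f [fW f_inj fact]].
have W2P w : w \in W2 -> exists2 v, v \in W1 & w = f v.
  by rewrite -fW => /memv_imgP.
split.
- by move=> s _ /W2P[v Wv ->]; rewrite -fact // -fW memv_img ?stW1.
- move=> W20; apply: W1n0; apply/eqP; rewrite -subv0; apply/subvP=> v Wv.
  rewrite memv0; apply/eqP; apply: f_inj; rewrite ?mem0v // linear0.
  by apply/eqP; rewrite -memv0 -W20 -fW memv_img.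
move=> X sXW stX; pose Y := (W1 :&: f @^-1: X)%VS.
have YP v : (v \in Y) = (v \in W1) && (f v \in X) by rewrite memv_cap memv_preim.
have fY : (f @: Y)%VS = X.
  apply/eqP; rewrite eqEsubv; apply/andP; split; apply/subvP=> w.
    by case/memv_imgP=> v; rewrite YP => /andP[_ Xv] ->.
  move=> Xw; have [v Wv Ew] := W2P w (subvP sXW w Xw).
  by rewrite Ew memv_img // YP Wv -Ew.
case: (irrW1 Y) => [||Y0|YW]; first exact: capvSl.
- by move=> s v; rewrite !YP => /andP[Wv Xv]; rewrite stW1 // fact // stX.
- by left; rewrite -fY Y0 limg0.
by right; rewrite -fY YW.
Qed.

End TwoModules.

Lemma submod_iso_trans (V1 V2 V3 : vectType rat) (act1 : 'S_n -> 'End(V1))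
    (act2 : 'S_n -> 'End(V2)) (act3 : 'S_n -> 'End(V3))
    (W1 : {vspace V1}) (W2 : {vspace V2}) (W3 : {vspace V3}) :
  submod_iso act1 W1 act2 W2 -> submod_iso act2 W2 act3 W3 ->
  submod_iso act1 W1 act3 W3.
Proof.
case=> f [fW f_inj fact] [h [hW h_inj hact]]; exists (h \o f)%VF; split.
- by rewrite limg_comp fW hW.
- move=> u v Wu Wv; rewrite !comp_lfunE => /h_inj E.
  by apply: f_inj => //; apply: E; rewrite -fW memv_img.
by move=> s v Wv; rewrite !comp_lfunE fact // hact // -fW memv_img.
Qed.

Section OrthogonalAction.
Variables (I : finType) (act : 'S_n -> 'End(Q[I])).
Hypothesis act_adj : forall s u v, dot (act s u) v = dot u (act s^-1%g v).

(** Schur's argument for the orthogonal projection [p] onto [Y], which is equivariant because the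
    action is orthogonal. If [u] and [v] are not orthogonal, [p u] is nonzero, so [p] is injective
    on [X] and maps it onto [Y]. *)
Lemma noniso_orthogonal (X Y : {vspace Q[I]}) :
  irreducible_submod act X -> irreducible_submod act Y ->
  ~ submod_iso act X act Y -> orthogonal_subspaces X Y.
Proof.
case=> stX _ irrX [stY _ irrY] nisoXY u v Xu Yv.
have [p [pY pP]] := orthogonal_proj Y.
have p_act s w : p (act s w) = act s (p w).
  apply/eqP; rewrite -subr_eq0; apply/eqP/dot_eq0.
  (* The defect [d] of equivariance lies in [Y], and [pP] makes it orthogonal to [Y]. *)
  set d := (X in dot X X); have Yd : d \in Y by rewrite memvB ?stY.
  rewrite {1}/d dotBl act_adj.
  have := pP (act s w) d Yd; rewrite dotBl => /eqP; rewrite subr_eq0 => /eqP <-.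
  by rewrite act_adj -dotBl pP ?stY.
apply/eqP; apply: contraT => uv0; case: nisoXY; exists p.
have pu0 : p u <> 0.
  by move=> pu; move: uv0; rewrite -(subr0 u) -pu pP // eqxx.
have kerX : (X :&: lker p = 0)%VS.
  case: (irrX (X :&: lker p)%VS) => // [|s w|kX]; first exact: capvSl.
    rewrite !memv_cap !memv_ker p_act => /andP[Xw /eqP->].
    by rewrite stX // linear0 /=.
  by case: pu0; apply/eqP; rewrite -memv_ker; move: Xu; rewrite -kX memv_cap => /andP[].
split.
- case: (irrY (p @: X)%VS) => //.
  + by apply/subvP=> _ /memv_imgP[w _ ->].
  + by move=> s _ /memv_imgP[w Xw ->]; rewrite -p_act memv_img ?stX.
  by move=> pX0; case: pu0; apply/eqP; rewrite -memv0 -pX0 memv_img.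
- move=> w1 w2 Xw1 Xw2 E; apply/eqP; rewrite -subr_eq0 -memv0 -kerX.
  by rewrite memv_cap memvB //= memv_ker linearB /= E subrr.
by move=> s w _; rewrite p_act.
Qed.

(** For [x] in [X] with components [w j], the difference [x - w j0] lies in the sum of the other
    [W j], which are orthogonal to [x] and to [w j0]; so it is orthogonal to itself. Thus [X] lies
    in the irreducible [W j0]. *)
Lemma isotypic_unique (J : finType) (P : pred J) (W : J -> {vspace Q[I]}) j0
    (X : {vspace Q[I]}) :
  P j0 -> (forall j, P j -> j != j0 -> orthogonal_subspaces (W j) (W j0)) ->
  irreducible_submod act (W j0) -> act_stable act X -> X <> 0%VS ->
  (X <= \sum_(j | P j) W j)%VS ->
  (forall j, P j -> j != j0 -> orthogonal_subspaces (W j) X) -> X = W j0.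
Proof.
move=> Pj0 orthW [stW _ irrW] stX Xn0 sXW orthX.
case: (irrW X) => //; apply/subvP=> x Xx.
have [w wW Ex] := memv_sumP (subvP sXW x Xx).
have Ex0 : x - w j0 = \sum_(j | P j && (j != j0)) w j.
  by rewrite Ex (bigD1 j0) //= addrAC subrr add0r.
suff : x - w j0 = 0 by move/eqP; rewrite subr_eq0 => /eqP->; exact: wW.
apply: dot_eq0; rewrite {1}Ex0 dotC dot_sumr big1 // => j /andP[Pj jj0].
rewrite dotC -scaleN1r dotDr dotZr (orthX j Pj jj0 (w j) x) ?wW //.
by rewrite (orthW j Pj jj0 (w j) (w j0)) ?wW // mulr0 addr0.
Qed.

End OrthogonalAction.

End Submodules.

(** * The sign twist of a Specht module *)

Section QuasiProjections.
Variables (I : finType).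
Implicit Types (A B : 'End(Q[I])) (a b : rat).

(** Equivalently [A] is [a] times an orthogonal projection. The scalar is kept so that symmetrizers
    over a subgroup fit without division by its order. *)
Definition quasi_projection A a :=
  [/\ forall x y, dot (A x) y = dot x (A y), a != 0 & forall x, A (A x) = a *: A x].

(* Positivity replaces von Neumann's lemma on Young symmetrizers here:
   [|A B x|^2 = a <x, B A B x>]. *)
Lemma quasi_projection_inj A a B b x :
  quasi_projection A a -> quasi_projection B b -> B (A (B x)) = 0 -> A (B x) = 0.
Proof.
move=> [adjA _ A2] [adjB _ _] BAB; apply: dot_eq0.
by rewrite adjA A2 dotZr adjB BAB dot0r mulr0.
Qed.

Lemma quasi_projection_dim A a B b :
  quasi_projection A a -> quasi_projection B b ->
  \dim (B @: limg (A \o B)%VF) = \dim (limg (A \o B)%VF).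
Proof.
move=> qA qB; apply: limg_dim_eq; apply/eqP; rewrite -subv0.
apply/subvP=> y; rewrite memv_cap memv_ker memv0 => /andP[/memv_imgP[x _ ->]].
by rewrite comp_lfunE => /eqP/(quasi_projection_inj qA qB)/eqP.
Qed.

(** Each of the two maps carries the image of one composite injectively into the image of the other,
    so the dimensions agree. This compares the left ideals generated by the two products of a
    symmetrizer and an antisymmetrizer. *)
Lemma quasi_projection_img A a B b :
  quasi_projection A a -> quasi_projection B b ->
  (B @: limg (A \o B)%VF)%VS = limg (B \o A)%VF.
Proof.
move=> qA qB.
have sub C D : (D @: limg (C \o D)%VF <= limg (D \o C)%VF)%VS.
  apply/subvP=> _ /memv_imgP[_ /memv_imgP[x _ ->] ->].
  by rewrite comp_lfunE -(comp_lfunE D C) memv_img ?memvf.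
apply/eqP; rewrite eqEdim sub /= (quasi_projection_dim qA qB).
by rewrite -(quasi_projection_dim qB qA) dimvS.
Qed.

End QuasiProjections.

Section SpechtTwist.
Variable d : nat.
Implicit Types (G : {set 'S_d}) (c : 'S_d -> rat) (x y : Q['S_d]).

(** As [p * w] is the map [w \o p], this is right multiplication by the element of the group algebra
    with coefficients [c] on [G]; hence it commutes with [grp_act]. *)
Definition rmul_sum G c : 'End(Q['S_d]) :=
  lin_ext (fun w : 'S_d => \sum_(p in G) c p *: basis_vec (p * w)%g).

Lemma rmul_sumE G c x w : rmul_sum G c x w = \sum_(p in G) c p * x (p^-1 * w)%g.
Proof.
rewrite lin_ext_coef.
under eq_bigr do rewrite sum_ffunE mulr_sumr.
rewrite exchange_big /=; apply: eq_bigr => p _.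
rewrite (bigD1 (p^-1 * w)%g) //= !ffunE mulKVg eqxx big1 ?addr0 => [|v nv].
  by rewrite -[_ *: _]/(_ * _) mulr1 mulrC.
rewrite !ffunE; case: eqP => [Ew|_]; last by rewrite scaler0 mulr0.
by rewrite Ew mulKg eqxx in nv.
Qed.

Lemma grp_actE s x w : grp_act s x w = x (w * s^-1)%g.
Proof.
exact: (@lin_ext_perm _ (fun w : 'S_d => (w * s)%g) (fun w => (w * s^-1)%g)
         (mulgK s) (mulgKV s)).
Qed.

Lemma eq_rmul_sum G c c' x : c =1 c' -> rmul_sum G c x = rmul_sum G c' x.
Proof.
by move=> Ec; apply/ffunP=> w; rewrite !rmul_sumE; apply: eq_bigr => p _; rewrite Ec.
Qed.

Lemma rmul_sum_grp_act G c s x :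
  rmul_sum G c (grp_act s x) = grp_act s (rmul_sum G c x).
Proof.
apply/ffunP=> w; rewrite grp_actE !rmul_sumE.
by apply: eq_bigr => p _; rewrite grp_actE mulgA.
Qed.

(** Self-adjointness comes from reindexing by inversion. In the square, multiplicativity of [c]
    makes the inner sums, translated by elements of [G], all equal. *)
Lemma rmul_sum_quasi_projection (G : {group 'S_d}) c :
  {morph c : p q / (p * q)%g >-> p * q} -> c 1%g = 1 -> (forall p, c p^-1%g = c p) ->
  quasi_projection (rmul_sum G c) #|G|%:R.
Proof.
move=> cM c1 cV; split.
- move=> x y; rewrite /dot.
  under eq_bigr do rewrite rmul_sumE mulr_suml.
  under [RHS]eq_bigr do rewrite rmul_sumE mulr_sumr.
  rewrite exchange_big [RHS]exchange_big [RHS](reindex_inj invg_inj) /=.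
  apply: eq_big => [p|p _]; first by rewrite groupV.
  rewrite (reindex_inj (mulgI p)) /=; apply: eq_bigr => w _.
  by rewrite invgK mulKg cV mulrA [x w * _]mulrC.
- by rewrite pnatr_eq0 -lt0n cardG_gt0.
move=> x; apply/ffunP=> w; rewrite ffunE !rmul_sumE.
under eq_bigr do rewrite rmul_sumE mulr_sumr.
transitivity (\sum_(p in G) \sum_(q in G) c q * x (q^-1 * w)%g).
  apply: eq_bigr => p Gp; rewrite [RHS](reindex_inj (mulgI p)) /=.
  apply: eq_big => [q|q _]; first by rewrite groupMl.
  by rewrite cM invMg mulrA mulgA.
by rewrite -[RHS]/(_ * _) sumr_const mulr_natl.
Qed.

Definition sign_twist : 'End(Q['S_d]) :=
  lin_ext (fun w : 'S_d => ((-1) ^+ w : rat) *: basis_vec w).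

Lemma sign_twistE x w : sign_twist x w = (-1) ^+ w * x w.
Proof.
rewrite lin_ext_coef (bigD1 w) //= !ffunE eqxx big1 ?addr0 => [|v nv].
  by rewrite -[_ *: _]/(_ * _) mulr1 mulrC.
by rewrite !ffunE eq_sym (negbTE nv) scaler0 mulr0.
Qed.

Lemma sign_twistK : involutive sign_twist.
Proof.
by move=> x; apply/ffunP=> w; rewrite !sign_twistE mulrA -expr2 sqrr_sign mul1r.
Qed.

Lemma sign_twist_grp_act s x :
  sign_twist (grp_act s x) = ((-1) ^+ s : rat) *: grp_act s (sign_twist x).
Proof.
apply/ffunP=> w; rewrite ffunE sign_twistE !grp_actE sign_twistE.
rewrite -[_ *: _]/(_ * _) mulrA odd_permM odd_permV signr_addb.
by rewrite mulrCA -expr2 sqrr_sign mulr1.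
Qed.

(** The signs absorbed into the coefficients interchange symmetrizers and antisymmetrizers. *)
Lemma sign_twist_rmul_sum G c x :
  sign_twist (rmul_sum G c x) = rmul_sum G (fun p => (-1) ^+ p * c p) (sign_twist x).
Proof.
apply/ffunP=> w; rewrite sign_twistE !rmul_sumE mulr_sumr.
apply: eq_bigr => p _; rewrite sign_twistE odd_permM odd_permV signr_addb.
by rewrite [RHS]mulrACA signrMK.
Qed.

Definition rtrans (t : 'S_d) : 'End(Q['S_d]) :=
  lin_ext (fun w : 'S_d => basis_vec (t * w)%g).

Lemma rtransE t x w : rtrans t x w = x (t^-1 * w)%g.
Proof.
exact: (@lin_ext_perm _ (fun w : 'S_d => (t * w)%g) (fun w => (t^-1 * w)%g)
         (mulKg t) (mulKVg t)).
Qed.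

Lemma rtransK t : cancel (rtrans t) (rtrans t^-1%g).
Proof. by move=> x; apply/ffunP=> w; rewrite !rtransE invgK mulKg. Qed.

(** Change of tableau: relabelling by [t] conjugates the stabilizers. The hypothesis on [c] covers
    both the constant [1] and the sign. *)
Lemma rtrans_rmul_sum t G c x : (forall p q, c (p ^ q)%g = c p) ->
  rtrans t (rmul_sum (G :^ t)%g c x) = rmul_sum G c (rtrans t x).
Proof.
move=> cJ; apply/ffunP=> w; rewrite rtransE !rmul_sumE.
rewrite (reindex_inj (conjg_inj t)) /=.
apply: eq_big => [p|p _]; first by rewrite memJ_conjg.
by rewrite cJ rtransE conjgE !invMg invgK !mulgA mulgK.
Qed.

(** [row_stab] and [col_stab] are the cases where [f] is the row or the column index in the
    canonical tableau. *)
Definition label_stab (f : 'I_d -> nat) : {set 'S_d} :=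
  [set s : 'S_d | [forall m, f (s m) == f m]].

Lemma label_stabP f (s : 'S_d) : reflect (forall m, f (s m) = f m) (s \in label_stab f).
Proof. by rewrite inE; apply: 'forall_eqP. Qed.

Lemma label_stab_group_set f : group_set (label_stab f).
Proof.
apply/group_setP; split=> [|s t /label_stabP fs /label_stabP ft].
  by apply/label_stabP=> m; rewrite perm1.
by apply/label_stabP=> m; rewrite permM ft fs.
Qed.
Canonical label_stab_group f := Group (label_stab_group_set f).

Lemma label_stab_conj f f' (t : 'S_d) : (forall m, f' (t m) = f m) ->
  label_stab f' = (label_stab f :^ t)%g.
Proof.
move=> ft; apply/setP=> s; rewrite mem_conjg.
apply/label_stabP/label_stabP => fs m.
  by rewrite conjgE invgK !permM -ft permKV fs ft.
by have := fs (t^-1 m)%g; rewrite conjgE invgK !permM -!ft !permKV.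
Qed.

Definition symmetrize f := rmul_sum (label_stab f) (fun=> 1).
Definition antisymmetrize f := rmul_sum (label_stab f) (fun p => (-1) ^+ p).

Lemma symmetrize_quasi f :
  quasi_projection (symmetrize f) #|label_stab f|%:R.
Proof.
by apply: (@rmul_sum_quasi_projection (label_stab_group f)) => // p q; rewrite mulr1.
Qed.

Lemma antisymmetrize_quasi f :
  quasi_projection (antisymmetrize f) #|label_stab f|%:R.
Proof.
apply: (@rmul_sum_quasi_projection (label_stab_group f)) => [p q||p] /=.
- by rewrite odd_permM signr_addb.
- by rewrite odd_perm1.
by rewrite odd_permV.
Qed.

(** The translates of the Young symmetrizer are the values of this composite on the basis vectors,
    so both spaces have the same generators. *)
Lemma spechtE nu :
  specht d nu = limg (antisymmetrize (fun m => reshape_offset nu m)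
                      \o symmetrize (fun m => reshape_index nu m))%VF.
Proof.
set A := symmetrize _; set B := antisymmetrize _.
have BA w : grp_act w (young_symmetrizer d nu) = B (A (basis_vec w)).
  rewrite [LHS]linear_sum [X in B X]lin_ext_basis [RHS]linear_sum /=.
  apply: eq_bigr => p _; rewrite linearZ /= scale1r lin_ext_basis linear_sum.
  by apply: eq_bigr => q _; rewrite linearZ /= lin_ext_basis mulgA.
apply/eqP; rewrite eqEsubv; apply/andP; split.
  apply/span_subvP=> _ /imageP[w _ ->].
  by rewrite BA -(comp_lfunE B A) memv_img ?memvf.
apply/subvP=> _ /memv_imgP[x _ ->]; rewrite (basis_decomp x) linear_sum.
apply: memv_suml => w _; rewrite linearZ memvZ //= comp_lfunE -BA.
by apply: memv_span; apply: image_f.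
Qed.

(** As [t] exchanges rows and columns and the sign exchanges symmetrization and antisymmetrization,
    [T] carries the image of [B' \o A'] to that of [A \o B]. The factors are now in the wrong order;
    applying [B] once more, which is injective there, gives the image of [B \o A]. *)
Lemma specht_twist nu nu' (t : 'S_d) :
  (forall m, reshape_index nu' (t m) = reshape_offset nu m) ->
  (forall m, reshape_offset nu' (t m) = reshape_index nu m) ->
  submod_iso (@grp_act d) (specht d nu') (sgn_act (@grp_act d)) (specht d nu).
Proof.
move=> idx off; rewrite !spechtE.
set A' := symmetrize _; set B' := antisymmetrize _.
set A := symmetrize _; set B := antisymmetrize _.
have qA : quasi_projection A _ := symmetrize_quasi _.
have qB : quasi_projection B _ := antisymmetrize_quasi _.
pose T := (sign_twist \o rtrans t)%VF.
have TBA x : T (B' (A' x)) = A (B (T x)).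
  rewrite /T !comp_lfunE /B' /antisymmetrize (label_stab_conj off).
  rewrite rtrans_rmul_sum => [|p q]; last by rewrite odd_permJ.
  rewrite /A' /symmetrize (label_stab_conj idx) rtrans_rmul_sum //.
  rewrite !sign_twist_rmul_sum; set y := sign_twist _.
  rewrite [in LHS](@eq_rmul_sum _ _ (fun=> 1)) => [|p]; last by rewrite -expr2 sqrr_sign.
  by congr (A _); apply: eq_rmul_sum => p; rewrite mulr1.
have T_inj : injective T.
  move=> x y; rewrite /T !comp_lfunE => /(can_inj sign_twistK).
  exact: (can_inj (@rtransK t)).
have T_onto y : T (rtrans t^-1%g (sign_twist y)) = y.
  by rewrite /T !comp_lfunE -{1}(invgK t) rtransK sign_twistK.
have TW : (T @: limg (B' \o A')%VF)%VS = limg (A \o B)%VF.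
  apply/eqP; rewrite eqEsubv; apply/andP; split; apply/subvP.
    move=> _ /memv_imgP[_ /memv_imgP[x _ ->] ->].
    by rewrite (comp_lfunE B' A') TBA -(comp_lfunE A B) memv_img ?memvf.
  move=> _ /memv_imgP[x _ ->]; rewrite (comp_lfunE A B) -(T_onto x) -TBA.
  by rewrite memv_img // -(comp_lfunE B' A') memv_img ?memvf.
exists (B \o T)%VF; split.
- by rewrite limg_comp TW (quasi_projection_img qA qB).
- move=> x y Wx Wy; rewrite !(comp_lfunE B T) => E.
  apply: T_inj; apply/eqP; rewrite -subr_eq0 -linearB /=.
  have : T (x - y) \in limg (A \o B)%VF by rewrite -TW memv_img ?memvB.
  have : B (T (x - y)) = 0 by rewrite !linearB /= E subrr.
  move=> BT0 /memv_imgP[z _ Ez]; move: BT0; rewrite Ez (comp_lfunE A B) => BT0.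
  by rewrite (quasi_projection_inj qA qB BT0).
move=> s x _; rewrite sgn_actE !comp_lfunE.
have -> : rtrans t (grp_act s x) = grp_act s (rtrans t x).
  by apply/ffunP=> w; rewrite rtransE grp_actE grp_actE rtransE mulgA.
by rewrite sign_twist_grp_act linearZ /= /B /antisymmetrize rmul_sum_grp_act.
Qed.

End SpechtTwist.

(** * Young diagrams *)

Lemma is_part_ofP k la :
  reflect [/\ sorted geq la, 0%N \notin la & sumn la = k] (is_part_of k la).
Proof. by apply: (iffP and3P) => [[? ? /eqP]|[? ? <-]]. Qed.

Lemma geq_trans : transitive geq.
Proof. by move=> y x z /= yx zy; apply: leq_trans zy yx. Qed.

Lemma leq_head s r : sorted geq s -> r \in s -> (r <= head 0%N s)%N.
Proof.
case: s => //= x s /(order_path_min geq_trans)/allP le_s.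
by rewrite inE => /predU1P[-> //|/le_s].
Qed.

(** In a nonincreasing list the entries exceeding [c] form an initial segment. *)
Lemma ltn_count_sorted s c i :
  sorted geq s -> (i < count (fun r => c < r) s)%N = (c < nth 0%N s i)%N.
Proof.
elim: s i => [|x s IH] i xs; first by rewrite nth_nil.
have /= := xs => /[dup] /(order_path_min geq_trans)/allP le_s /path_sorted ss.
case: (ltnP c x) => [lt_cx|le_xc] /=; first by case: i => [|i] //=; rewrite ltnS IH.
have -> : count (fun r => c < r)%N s = 0%N.
  apply/eqP; rewrite -leqn0 leqNgt -has_count; apply/hasPn=> r /le_s /= le_rx.
  by rewrite -leqNgt (leq_trans le_rx).
case: i => [|i] /=; rewrite ltn0; apply/esym/negbTE; rewrite -leqNgt //.
have [lt_i|/(nth_default 0%N)->//] := ltnP i (size s).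
by apply: leq_trans le_xc; apply/le_s/mem_nth.
Qed.

Lemma size_conj_part la : size (conj_part la) = head 0%N la.
Proof. by rewrite size_map size_iota. Qed.

(** Transposition of cells; the default [0] of [nth] makes the equivalence hold also for rows and
    columns outside the diagram. *)
Lemma ltn_nth_conj_part la c i :
  sorted geq la -> (i < nth 0%N (conj_part la) c)%N = (c < nth 0%N la i)%N.
Proof.
move=> sla; case: (ltnP c (head 0%N la)) => [lt_c|le_c].
  by rewrite (nth_map 0%N) ?size_iota // nth_iota // ltn_count_sorted.
rewrite nth_default ?size_conj_part //; apply/esym/negbTE; rewrite -leqNgt.
have [lt_i|/(nth_default 0%N)->//] := ltnP i (size la).
by apply: leq_trans le_c; apply/leq_head/mem_nth.
Qed.

(** Double counting: a row of length [r] is counted once for each [j < r]. A bound [n] replaces the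
    head of the list so that induction on [la] applies. *)
Lemma sumn_count_lt n la : {in la, forall r, r <= n}%N ->
  sumn [seq count (fun r => j < r)%N la | j <- iota 0 n] = sumn la.
Proof.
elim: la => [|x la IH] le_n.
  by rewrite /=; elim: (iota 0 n) => //= j s ->.
have -> : sumn [seq count (fun r => j < r)%N (x :: la) | j <- iota 0 n]
    = (sumn [seq (j < x : nat)%N | j <- iota 0 n]
       + sumn [seq count (fun r => j < r)%N la | j <- iota 0 n])%N.
  by elim: (iota 0 n) => //= j s ->; rewrite addnACA.
rewrite {}IH => [|r la_r]; last by rewrite le_n // inE la_r orbT.
congr addn; rewrite sumn_count -size_filter -[RHS](size_iota 0); congr size.
have le_xn := le_n x (mem_head x la).
rewrite -{1}(subnKC le_xn) iotaD filter_cat add0n.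
rewrite (all_filterP _); last by apply/allP=> j; rewrite mem_iota.
rewrite (eq_in_filter (a2 := pred0)) ?filter_pred0 ?cats0 // => j.
by rewrite mem_iota => /andP[le_xj _]; rewrite ltnNge le_xj.
Qed.

Lemma conj_part_of k la : is_part_of k la -> is_part_of k (conj_part la).
Proof.
case/is_part_ofP=> sla la0 <-; apply/is_part_ofP; split.
- apply: (homo_sorted (e := leq)) (iota_sorted 0 _) => i j le_ij.
  by apply: sub_count => r /=; apply: leq_ltn_trans.
- apply/mapP=> [[c]]; rewrite mem_iota /= => lt_c /esym/eqP.
  rewrite -leqn0 leqNgt -has_count => /hasPn/(_ (head 0%N la)).
  by case: la lt_c {sla la0} => //= x la lt_c; rewrite lt_c mem_head => /(_ isT).
by apply: sumn_count_lt => r; apply: leq_head.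
Qed.

Lemma part_eq_nth la nu : 0%N \notin la -> 0%N \notin nu ->
  (forall i, nth 0%N la i = nth 0%N nu i) -> la = nu.
Proof.
move=> la0 nu0 E; apply: (@eq_from_nth _ 0%N) => //.
have le s t : 0%N \notin s -> (forall i, nth 0%N s i = nth 0%N t i) ->
    (size s <= size t)%N.
  move=> s0 Est; rewrite leqNgt; apply/negP=> lt_ts.
  have := mem_nth 0%N lt_ts; rewrite Est nth_default // => s0'.
  by rewrite s0' in s0.
by apply/eqP; rewrite eqn_leq !le.
Qed.

Lemma conj_part_inj k : {in is_part_of k &, injective conj_part}.
Proof.
move=> la nu /is_part_ofP[sla la0 _] /is_part_ofP[snu nu0 _] E.
apply: part_eq_nth => // i.
have lt c : (c < nth 0 la i)%N = (c < nth 0 nu i)%N.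
  by rewrite -ltn_nth_conj_part // E ltn_nth_conj_part.
by apply/eqP; rewrite eqn_leq; apply/andP; split; rewrite leqNgt;
  [rewrite lt | rewrite -lt]; rewrite ltnn.
Qed.

Lemma young_rows k la : is_part_of k la -> exists nu : young k, rows nu = la.
Proof.
move=> pla; have /is_part_ofP[_ la0 Ek] := pla.
have szla : (size la <= k)%N.
  rewrite -Ek; elim: la la0 {pla Ek} => //= x la IH.
  rewrite inE negb_or eq_sym -lt0n => /andP[x0 la0].
  by rewrite -add1n leq_add // IH.
have la_lt r : r \in la -> (r < k.+1)%N.
  rewrite ltnS -Ek; elim: la {pla la0 Ek szla} => //= x la IH.
  rewrite inE => /predU1P[->|/IH le_r]; first exact: leq_addr.
  exact: leq_trans le_r (leq_addl _ _).
pose s : seq 'I_k.+1 := map inord la.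
have Es : map val s = la.
  by rewrite -map_comp map_id_in // => r /la_lt lt_r; rewrite /= inordK.
have szs : (size s <= k)%N by rewrite size_map.
have ps : is_part_of k (map val (Bseq szs)) by rewrite /= Es.
by exists (Sub (Bseq szs) ps); rewrite /rows SubK.
Qed.

Lemma rows_part k (nu : young k) : is_part_of k (rows nu).
Proof. exact: (valP nu). Qed.

Lemma rows_inj k : injective (@rows k).
Proof. by move=> la nu /(inj_map val_inj)/val_inj/val_inj. Qed.

Lemma nth_delta_part la r : nth 0%N (delta_part la) r = nth 0%N la r./2.
Proof.
elim: la r => [|x la IH] r; first by rewrite !nth_nil.
by case: r => [|[|r]] //=; rewrite -IH.
Qed.

Lemma nth_double_part la r : nth 0%N (double_part la) r = (nth 0%N la r).*2.
Proof.
have [lt_r|le_r] := ltnP r (size la); first by rewrite (nth_map 0%N).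
by rewrite !nth_default ?size_map.
Qed.

Lemma sumn_delta_part la : sumn (delta_part la) = (sumn la).*2.
Proof.
by elim: la => //= x la IH; rewrite -/(delta_part la) IH doubleD addnA addnn.
Qed.

Lemma sumn_double_part la : sumn (double_part la) = (sumn la).*2.
Proof. by elim: la => //= x la ->; rewrite doubleD. Qed.

(** Row [r] of [delta_part la] is row [r./2] of [la], and [r < x.*2] means [r./2 < x]. *)
Lemma ltn_nth_delta_part la r c : sorted geq la ->
  (c < nth 0%N (delta_part la) r)%N = (r < nth 0%N (double_part (conj_part la)) c)%N.
Proof.
move=> sla; rewrite nth_delta_part nth_double_part -ltn_nth_conj_part //.
by rewrite ltn_half_double.
Qed.

(* The diagram [2 la'] is the transpose of [la^delta]; [t] transposes the
   canonical tableaux. *)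
Lemma transpose_tableau k la : is_part_of k la ->
  exists t : 'S_(2 * k),
    (forall m, reshape_index (double_part (conj_part la)) (t m)
                 = reshape_offset (delta_part la) m) /\
    (forall m, reshape_offset (double_part (conj_part la)) (t m)
                 = reshape_index (delta_part la) m).
Proof.
move=> pla; have /is_part_ofP[sla _ Ek] := pla.
have /is_part_ofP[_ _ Ek'] := conj_part_of pla.
set nu := delta_part la; set nu' := double_part _.
have cell (m : 'I_(2 * k)) :
    (reshape_index nu m < nth 0%N nu' (reshape_offset nu m))%N.
  rewrite -ltn_nth_delta_part //; apply: reshape_offsetP.
  by rewrite sumn_delta_part Ek -mul2n.
have lt_t (m : 'I_(2 * k)) :
    (flatten_index nu' (reshape_offset nu m) (reshape_index nu m) < 2 * k)%N.
  by have := flatten_indexP (cell m); rewrite sumn_double_part Ek' -mul2n.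
pose t m := Ordinal (lt_t m).
have t_inj : injective t.
  move=> m1 m2 /(congr1 val) /= E; apply: val_inj => /=.
  rewrite -(reshape_indexK nu m1) -(reshape_indexK nu m2).
  by congr flatten_index; [rewrite -(flatten_indexKr (cell m1)) E flatten_indexKr
    | rewrite -(flatten_indexKl (cell m1)) E flatten_indexKl].
exists (perm t_inj); split=> m; rewrite permE /=.
  exact: flatten_indexKl.
exact: flatten_indexKr.
Qed.

Lemma specht_conj_twist k la : is_part_of k la ->
  submod_iso (@grp_act (2 * k)) (specht (2 * k) (double_part (conj_part la)))
    (sgn_act (@grp_act (2 * k))) (specht (2 * k) (delta_part la)).
Proof. by case/transpose_tableau=> t [idx off]; apply: (specht_twist idx off). Qed.

(** * Signs and pairings of chord diagrams *)

Section WordSign.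
Variable n : nat.
Implicit Types (w : seq 'I_n) (s : seq ('I_n * 'I_n)) (t : 'S_n).

(** Zero on a word that does not enumerate ['I_n], so that [word_sign_map] holds for every word. *)
Definition word_sign w : rat :=
  oapp (fun u : 'S_n => (-1) ^+ u) 0 [pick u : 'S_n | map u (enum 'I_n) == w].

Lemma word_sign_perm (u : 'S_n) : word_sign (map u (enum 'I_n)) = (-1) ^+ u.
Proof.
rewrite /word_sign; case: pickP => [v /eqP/eq_in_map Euv|/(_ u)]; last by rewrite eqxx.
by congr (_ ^+ odd_perm _); apply/permP=> i; apply: Euv; rewrite mem_enum.
Qed.

Lemma word_sign_map t w : word_sign (map t w) = (-1) ^+ t * word_sign w.
Proof.
rewrite {2}/word_sign; case: pickP => [u /eqP <-|nw] /=.
  rewrite -map_comp -(eq_map (permM u t)) word_sign_perm odd_permM signr_addb.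
  by rewrite mulrC.
rewrite mulr0 /word_sign; case: pickP => //= u /eqP Eu.
have /eqP[] := nw (u * t^-1)%g.
by rewrite (eq_map (permM _ _)) map_comp Eu -map_comp map_id_in // => i _ /=; rewrite permK.
Qed.

Lemma map_perm_nth (u : 'S_n) w :
  size w = n -> (forall m, u m = nth m w m) -> map u (enum 'I_n) = w.
Proof.
move=> sw Eu; have [n0|n_gt0] := posnP n.
  transitivity (Nil 'I_n); [|apply/esym]; apply: size0nil.
    by rewrite size_map size_enum_ord.
  by rewrite sw.
pose i0 := Ordinal n_gt0.
apply: (@eq_from_nth _ i0) => [|i]; rewrite size_map size_enum_ord ?sw // => lt_in.
rewrite (nth_map i0) ?size_enum_ord // Eu.
by rewrite -[i]/(val (Ordinal lt_in)) nth_ord_enum /= (set_nth_default i0) ?sw.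
Qed.

Lemma word_sign_sqr w : uniq w -> size w = n -> word_sign w ^+ 2 = 1.
Proof.
move=> uw sw; have nth_inj : injective (fun m : 'I_n => nth m w m).
  move=> m1 m2; rewrite (set_nth_default m2) ?sw // => /eqP.
  by rewrite nth_uniq ?sw // => /eqP/val_inj.
have <- : map (perm nth_inj) (enum (ordinal n)) = w.
  by apply: map_perm_nth => // m; rewrite permE.
by rewrite word_sign_perm sqrr_sign.
Qed.

Definition pair_word s := flatten [seq [:: p.1; p.2] | p <- s].
Arguments pair_word : simpl never.

Lemma pair_word_cons p s : pair_word (p :: s) = [:: p.1, p.2 & pair_word s].
Proof. by []. Qed.

Lemma pair_word_cat s1 s2 : pair_word (s1 ++ s2) = pair_word s1 ++ pair_word s2.
Proof. by rewrite /pair_word map_cat flatten_cat. Qed.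

Lemma pair_word_map (f : 'I_n -> 'I_n) s :
  pair_word [seq (f p.1, f p.2) | p <- s] = map f (pair_word s).
Proof. by elim: s => //= p s IH; rewrite !pair_word_cons IH. Qed.

Lemma size_pair_word s : size (pair_word s) = (2 * size s)%N.
Proof. by elim: s => [|p s IH]; [rewrite muln0 | rewrite pair_word_cons /= IH mulnS]. Qed.

Lemma mem_pair_word s i :
  (i \in pair_word s) = has (fun p => i \in [set p.1; p.2]) s.
Proof. by elim: s => //= p s IH; rewrite pair_word_cons !inE IH orbA. Qed.

Lemma mem_pair_word_full s i :
  uniq (pair_word s) -> size (pair_word s) = n -> i \in pair_word s.
Proof.
move=> us sz; have [||_ ->] := @uniq_min_size _ (pair_word s) (enum 'I_n) us.
- by move=> j _; rewrite mem_enum.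
- by rewrite size_enum_ord sz.
by rewrite mem_enum.
Qed.

Section Value.
Variables (X : Type) (om : X -> X -> rat) (h : 'I_n -> X).
Hypothesis om_alt : forall a b, om a b = - om b a.

Definition pair_prod s := \prod_(p <- s) om (h p.1) (h p.2).
Definition signed_prod s := word_sign (pair_word s) * pair_prod s.

Lemma tperm_notin (a b : 'I_n) w : a \notin w -> b \notin w -> map (tperm a b) w = w.
Proof.
move=> wa wb; rewrite map_id_in // => i wi.
by rewrite tpermD //; [move: wa|move: wb]; apply: contraNneq => ->.
Qed.

(** Exchanging two pairs moves the letters by two disjoint transpositions, an even permutation. *)
Lemma signed_prod_swap s1 p q s2 : uniq (pair_word (s1 ++ p :: q :: s2)) ->
  signed_prod (s1 ++ p :: q :: s2) = signed_prod (s1 ++ q :: p :: s2).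
Proof.
case: p q => [a b] [c e] u; rewrite /signed_prod; congr (_ * _); last first.
  by rewrite /pair_prod !big_cat !big_cons /=; congr (_ * _); rewrite mulrCA.
pose t := (tperm a c * tperm b e)%g.
have -> : pair_word (s1 ++ (c, e) :: (a, b) :: s2)
        = map t (pair_word (s1 ++ (a, b) :: (c, e) :: s2)).
  rewrite (eq_map (permM _ _)) map_comp.
  move: u; rewrite !pair_word_cat !pair_word_cons cat_uniq /= !inE !negb_or.
  case/and3P=> _ /and5P[ia ib ic ie _].
  case/and5P=> /and4P[nab nac nae na2] /and3P[nbc nbe nb2] /andP[nce nc2] ne2 _.
  have Ea : tperm b e (tperm a c a) = c by rewrite tpermL tpermD // 1?eq_sym.
  have Eb : tperm b e (tperm a c b) = e by rewrite (@tpermD _ a c b) ?tpermL // eq_sym.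
  have Ec : tperm b e (tperm a c c) = a by rewrite tpermR tpermD // 1?eq_sym.
  have Ee : tperm b e (tperm a c e) = b by rewrite (@tpermD _ a c e) ?tpermR.
  by rewrite !map_cat /= Ea Eb Ec Ee !tperm_notin.
rewrite word_sign_map odd_permM !odd_tperm.
move: u; rewrite pair_word_cat !pair_word_cons cat_uniq /= !inE !negb_or.
by case/and5P=> _ _ /and4P[_ -> _ _] /and3P[_ -> _] _; rewrite mul1r.
Qed.

(** The transposition of the two letters changes the sign of the word, and [om_alt] changes the sign
    of the factor. *)
Lemma signed_prod_flip s1 p s2 : uniq (pair_word (s1 ++ p :: s2)) ->
  signed_prod (s1 ++ p :: s2) = signed_prod (s1 ++ (p.2, p.1) :: s2).
Proof.
case: p => [a b] u; rewrite /signed_prod.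
have -> : pair_word (s1 ++ (b, a) :: s2)
        = map (tperm a b) (pair_word (s1 ++ (a, b) :: s2)).
  move: u; rewrite !pair_word_cat !pair_word_cons cat_uniq /= !inE !negb_or.
  case/and3P=> _ /and3P[ia ib _] /and3P[/andP[nab na2] nb2 _].
  by rewrite map_cat /= !tperm_notin // tpermL tpermR.
rewrite word_sign_map odd_tperm.
move: u; rewrite pair_word_cat pair_word_cons cat_uniq /= !inE !negb_or.
case/and5P=> _ _ /andP[-> _] _ _.
rewrite /pair_prod !big_cat !big_cons /= (om_alt (h b)) expr1.
by rewrite mulN1r !mulNr !mulrN opprK.
Qed.

Lemma signed_prod_front s0 s1 p s2 : uniq (pair_word (s0 ++ s1 ++ p :: s2)) ->
  signed_prod (s0 ++ s1 ++ p :: s2) = signed_prod (s0 ++ p :: s1 ++ s2).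
Proof.
elim: s1 s0 => //= q s1 IH s0 u.
have := IH (rcons s0 q); rewrite !cat_rcons => -> //.
have up : perm_eq (pair_word (s0 ++ q :: s1 ++ p :: s2))
           (pair_word (s0 ++ q :: p :: s1 ++ s2)).
  rewrite !(pair_word_cat, pair_word_cons) perm_cat2l.
  rewrite -[X in perm_eq X]/([:: q.1; q.2] ++ _)
    -[X in perm_eq _ X]/([:: q.1, q.2, p.1 & [:: p.2]] ++ _).
  by rewrite -[_ :: _ :: pair_word s2]/([:: p.1; p.2] ++ _) perm_cat2l perm_catCA.
by rewrite signed_prod_swap // -(perm_uniq up).
Qed.

Lemma mem_pair_sets_cons p s (B : {set 'I_n}) : uniq (pair_word (p :: s)) ->
  (B \in [seq [set r.1; r.2] | r <- s])
    = (B != [set p.1; p.2]) && (B \in [seq [set r.1; r.2] | r <- p :: s]).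
Proof.
move=> u; rewrite inE; case: eqP => //= ->; apply/mapP=> [[r sr Epr]].
move: u; rewrite pair_word_cons /= inE negb_or => /andP[/andP[_ np] _]; case/negP: np.
by rewrite mem_pair_word; apply/hasP; exists r => //; rewrite -Epr set21.
Qed.

(** The rules for exchanging and reversing pairs make the value depend only on the set of chords.
    The prefix [s0] holds the pairs already matched: the pair of [s'] with the same ends as [p] is
    brought to the front and, if needed, reversed. *)
Lemma signed_prod_eq s0 s s' :
  uniq (pair_word (s0 ++ s)) -> uniq (pair_word (s0 ++ s')) ->
  [seq [set p.1; p.2] | p <- s] =i [seq [set p.1; p.2] | p <- s'] ->
  signed_prod (s0 ++ s) = signed_prod (s0 ++ s').
Proof.
elim: s s0 s' => [|p s IH] s0 s' u u' E.
  by case: s' E {u'} => // p s' /(_ [set p.1; p.2]); rewrite mem_head.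
have /mapP[q s'q Epq] : [set p.1; p.2] \in [seq [set r.1; r.2] | r <- s'].
  by rewrite -E mem_head.
case/splitPr: s'q u' E => s1 s2 u' E.
have uq : uniq (pair_word (s0 ++ q :: s1 ++ s2)).
  move: u'; rewrite !(pair_word_cat, pair_word_cons) => u'.
  rewrite (perm_uniq (s2 := pair_word s0 ++ pair_word s1 ++ q.1 :: q.2 :: pair_word s2)) //.
  by rewrite perm_cat2l; apply/permEl/(perm_catCA [:: q.1; q.2]).
rewrite signed_prod_front //.
have {u' E} E : [seq [set r.1; r.2] | r <- p :: s]
             =i [seq [set r.1; r.2] | r <- p :: s1 ++ s2].
  by move=> B; rewrite E /= !map_cat /= !(mem_cat, inE) Epq orbCA.
have uniqr s3 s4 : uniq (pair_word (s3 ++ s4)) -> uniq (pair_word s4).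
  by rewrite pair_word_cat cat_uniq => /and3P[].
have [u2 ->] : uniq (pair_word (s0 ++ p :: s1 ++ s2)) /\
    signed_prod (s0 ++ q :: s1 ++ s2) = signed_prod (s0 ++ p :: s1 ++ s2).
  case: p q Epq uq {u E} => [a b] [c e] /= Epq uq.
  have ne_ce : c != e.
    by move/uniqr: uq => /=; rewrite inE negb_or => /andP[/andP[]].
  have : (a \in [set c; e]) && (b \in [set c; e]) by rewrite -Epq !inE !eqxx orbT.
  have : (c \in [set a; b]) && (e \in [set a; b]) by rewrite Epq !inE !eqxx orbT.
  rewrite !inE => /andP[Hc He] /andP[/orP[]/eqP Ea /orP[]/eqP Eb]; subst a b => //.
  - by move: He ne_ce; rewrite orbb eq_sym => ->.
  - rewrite signed_prod_flip //; split=> //.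
    move: uq; rewrite !(pair_word_cat, pair_word_cons) => uq.
    rewrite (perm_uniq (s2 := pair_word s0 ++ c :: e :: pair_word s1 ++ pair_word s2)) //.
    by rewrite perm_cat2l; apply/permEl/(perm_catCA [:: e] [:: c]).
  - by move: Hc ne_ce; rewrite orbb => ->.
rewrite -!cat_rcons; apply: IH; rewrite ?cat_rcons // => B.
rewrite (@mem_pair_sets_cons p s) ?(uniqr _ _ u) //.
by rewrite (@mem_pair_sets_cons p (s1 ++ s2)) ?(uniqr _ _ u2) // E.
Qed.

End Value.
End WordSign.

Arguments pair_word : simpl never.

(** * Chord diagrams as lists of pairs and as involutions *)

Section Chords.
Variable k : nat.
Implicit Types (C D : chord k) (s t : seq ('I_(2 * k) * 'I_(2 * k))) (i j : 'I_(2 * k)).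

Definition pair_sets s : seq {set 'I_(2 * k)} := [seq [set p.1; p.2] | p <- s].

(** The order of the pairs and of their ends is free, so a computation can choose the list that
    suits it. *)
Definition represents s C :=
  uniq (pair_word s) /\ forall B, (B \in val C) = (B \in pair_sets s).

Lemma chord_card2 C (B : {set 'I_(2 * k)}) : B \in val C -> #|B| = 2%N.
Proof.
have /andP[_ /forall_inP cardC] : is_chord_diagram (val C) := valP C.
by move/cardC/eqP.
Qed.

Lemma represents_chords C : represents (chords C) C.
Proof.
split=> [|B]; first exact: chord_word_uniq.
apply/idP/mapP=> [CB|[p + ->]]; last by rewrite mem_chords => /andP[].
have /eqP/cards2P[a [b [ne_ab EB]]] := chord_card2 CB.
have [lt_ab|lt_ba|/val_inj Eab] := ltngtP a b; last by rewrite Eab eqxx in ne_ab.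
  by exists (a, b); rewrite // mem_chords lt_ab -EB.
by exists (b, a); rewrite 1?mem_chords /= ?lt_ba setUC -EB.
Qed.

Lemma represents_size s C : represents s C -> size s = k.
Proof.
case=> us Es; apply/eqP; rewrite -(eqn_pmul2l (m := 2)) // -size_pair_word.
rewrite -(card_uniqP us) -[X in _ == X]card_ord; apply/eqP/eq_card => i.
have := mem_chord_word C i; rewrite inE -[chord_word C]/(pair_word (chords C)) mem_pair_word.
case/hasP=> p Cp ip; have [_ EC] := represents_chords C.
have : [set p.1; p.2] \in pair_sets s by rewrite -Es EC; apply: map_f.
by case/mapP=> q sq Epq; rewrite mem_pair_word; apply/hasP; exists q; rewrite // -Epq.
Qed.

Lemma represents_extend t C : uniq (pair_word t) ->
  {subset pair_sets t <= val C} -> exists s, represents (t ++ s) C.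
Proof.
move=> ut tC; have [uC EC] := represents_chords C.
exists [seq p <- chords C | [set p.1; p.2] \notin pair_sets t]; split=> [|B].
  rewrite pair_word_cat cat_uniq ut /=; apply/andP; split; last first.
    move: uC.
    elim: (chords C) => // p s IH; rewrite pair_word_cons /= inE negb_or.
    case/and3P=> /andP[np1 ps1] ps2 us.
    have sub : {subset pair_word [seq p <- s | [set p.1; p.2] \notin pair_sets t]
                 <= pair_word s}.
      move=> i; rewrite !mem_pair_word => /hasP[q]; rewrite mem_filter => /andP[_ sq] iq.
      by apply/hasP; exists q.
    case: ifP => _; last exact: IH.
    rewrite pair_word_cons /= inE negb_or np1 IH // andbT.
    by rewrite (contra (sub _) ps1) (contra (sub _) ps2).
  apply/hasPn=> i; rewrite mem_pair_word => /hasP[q].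
  rewrite mem_filter => /andP[nq Cq] iq; apply: contra nq.
  rewrite mem_pair_word => /hasP[r tr ir].
  have Cr : [set r.1; r.2] \in val C by apply/tC/map_f.
  have Cq' : [set q.1; q.2] \in val C by rewrite EC; apply: map_f.
  by rewrite (chord_block Cq' Cr iq ir); apply: map_f.
rewrite /pair_sets map_cat mem_cat -/(pair_sets t).
apply/idP/orP=> [CB|[/tC//|/mapP[p]]]; last first.
  by rewrite mem_filter => /andP[_ Cp] ->; rewrite EC; apply: map_f.
have [tB|tB] := boolP (B \in pair_sets t); [by left | right].
move: (CB); rewrite EC => /mapP[p Cp Ep]; apply/mapP.
by exists p; rewrite // mem_filter -Ep tB.
Qed.

Lemma represents_perm (u : 'S_(2 * k)) s C : represents s C ->
  represents [seq (u p.1, u p.2) | p <- s] (perm_chord u C).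
Proof.
case=> us Es; split=> [|B].
  by rewrite pair_word_map map_inj_uniq //; apply: perm_inj.
rewrite /pair_sets -map_comp SubK; apply/imsetP/mapP => [[A]|[p sp ->]].
  rewrite Es => /mapP[p sp ->] ->; exists p => //=.
  by rewrite imsetU !imset_set1.
exists [set p.1; p.2]; last by rewrite imsetU !imset_set1.
by rewrite Es; apply: map_f.
Qed.

Lemma sgn_word C : sgn C = word_sign (pair_word (chords C)).
Proof.
rewrite -[pair_word _]/(chord_word C) /sgn -word_sign_perm; congr word_sign.
by apply: map_perm_nth => [|m]; rewrite ?size_chord_word ?permE.
Qed.

Lemma sgn_sqr C : sgn C ^+ 2 = 1.
Proof. by rewrite sqrr_sign. Qed.

(** The fixed-point-free involution attached to [C]; the default [i] is never reached, as every
    vertex lies on a chord. *)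
Definition partner C i := odflt i [pick j | [set i; j] \in val C].

Lemma mem_partner C i j : ([set i; j] \in val C) = (j == partner C i).
Proof.
have neq j' : [set i; j'] \in val C -> i != j'.
  by move/chord_card2; rewrite cards2; case: eqP.
have [j0 Cj0] : exists j', [set i; j'] \in val C.
  have := mem_chord_word C i; rewrite -[chord_word C]/(pair_word (chords C)) mem_pair_word.
  case/hasP=> [[a b]]; rewrite mem_chords => /andP[_ /= Cab].
  rewrite !inE => /orP[]/eqP->; first by exists b.
  by exists a; rewrite setUC.
rewrite /partner; case: pickP => [j1 Cj1|/(_ j0)]; last by rewrite Cj0.
apply/idP/eqP => [Cj|->] //=.
have := chord_block Cj Cj1 (set21 i j) (set21 i j1) => E.
have : j \in [set i; j1] by rewrite -E set22.
by rewrite !inE eq_sym (negbTE (neq _ Cj)) => /eqP.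
Qed.

Lemma partnerP C i : [set i; partner C i] \in val C.
Proof. by rewrite mem_partner. Qed.

Lemma partner_neq C i : partner C i != i.
Proof. by have := chord_card2 (partnerP C i); rewrite cards2 eq_sym; case: eqP. Qed.

Lemma partnerK C : involutive (partner C).
Proof. by move=> i; apply/esym/eqP; rewrite -mem_partner setUC partnerP. Qed.

Lemma partner_inj C D : partner C =1 partner D -> C = D.
Proof.
move=> E; apply/val_inj/setP=> B; apply/idP/idP=> CB.
  have /eqP/cards2P[a [b [_ EB]]] := chord_card2 CB.
  by move: CB; rewrite EB !mem_partner E.
have /eqP/cards2P[a [b [_ EB]]] := chord_card2 CB.
by move: CB; rewrite EB !mem_partner E.
Qed.

Lemma partner_perm (u : 'S_(2 * k)) C i : partner (perm_chord u C) (u i) = u (partner C i).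
Proof.
apply/esym/eqP; rewrite -mem_partner SubK; apply/imsetP.
by exists [set i; partner C i]; rewrite ?partnerP // imsetU !imset_set1.
Qed.

Section ChordValue.
Variables (X : Type) (om : X -> X -> rat).
Hypothesis om_alt : forall a b, om a b = - om b a.
Implicit Type h : 'I_(2 * k) -> X.

(** For [om := omega0] this is the coefficient of [a_C] at the basis tensor [h], and also the value
    of [alpha_C] on that basis tensor. *)
Definition chord_value C h := sgn C * \prod_(p <- chords C) om (h p.1) (h p.2).

Lemma chord_value_represents s C h : represents s C ->
  chord_value C h = word_sign (pair_word s) * \prod_(p <- s) om (h p.1) (h p.2).
Proof.
case=> us Es; rewrite /chord_value sgn_word.
have [uC EC] := represents_chords C.
by apply: (@signed_prod_eq _ _ om h om_alt [::]) => // B; rewrite -[LHS]EC -[RHS]Es.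
Qed.

Lemma chord_value_perm (u : 'S_(2 * k)) C h :
  chord_value (perm_chord u C) h = (-1) ^+ u * chord_value C (h \o u).
Proof.
have rC := represents_chords C.
rewrite (chord_value_represents _ (represents_perm u rC)) (chord_value_represents _ rC).
by rewrite pair_word_map word_sign_map big_map mulrA.
Qed.

End ChordValue.
End Chords.

(** * The Gram matrix of chord diagrams *)

Section Update.
Variables (n : nat) (X : finType).
Implicit Types (h : {ffun 'I_n -> X}) (i j : 'I_n) (a b : X).

Definition upd h i a : {ffun 'I_n -> X} := [ffun j => if j == i then a else h j].

Lemma upd_same h i a : upd h i a i = a.
Proof. by rewrite ffunE eqxx. Qed.

Lemma upd_neq h i j a : j != i -> upd h i a j = h j.
Proof. by rewrite ffunE => /negbTE->. Qed.

Lemma updC h i j a b : i != j -> upd (upd h i a) j b = upd (upd h j b) i a.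
Proof.
move=> ne_ij; apply/ffunP=> l; rewrite !ffunE; case: eqP => // ->.
by rewrite eq_sym (negbTE ne_ij).
Qed.

Lemma upd_upd h i a b : upd (upd h i a) i b = upd h i b.
Proof. by apply/ffunP=> l; rewrite !ffunE; case: eqP. Qed.

Lemma upd_id h i : upd h i (h i) = h.
Proof. by apply/ffunP=> l; rewrite ffunE; case: eqP => [->|]. Qed.

(** Exchanging [a] with the value at slot [i] is an involution on the pairs [(h, a)]. Overwriting a
    slot in this way allows summing over it without decomposing the index type. *)
Lemma sum_upd (F : {ffun 'I_n -> X} -> rat) i :
  \sum_h \sum_a F (upd h i a) = #|X|%:R * \sum_h F h.
Proof.
rewrite pair_bigA /=.
pose flip (p : {ffun 'I_n -> X} * X) := (upd p.1 i p.2, p.1 i).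
have flipK : involutive flip by case=> h a; rewrite /flip /= upd_same upd_upd upd_id.
rewrite (reindex flip) /=; last by exists flip => p _; rewrite flipK.
transitivity (\sum_(p : {ffun 'I_n -> X} * X) F p.1).
  by apply: eq_bigr => [[h a]] _ /=; rewrite upd_upd upd_id.
rewrite -(pair_bigA _ (fun h (a : X) => F h)) /= mulr_sumr; apply: eq_bigr => h _.
by rewrite sumr_const mulr_natl.
Qed.

Lemma sum_upd2 (F : {ffun 'I_n -> X} -> rat) i j :
  \sum_h \sum_a \sum_b F (upd (upd h i a) j b) = #|X|%:R ^+ 2 * \sum_h F h.
Proof.
by rewrite (sum_upd (fun h => \sum_b F (upd h j b))) sum_upd mulrA.
Qed.

Lemma prod_upd (s : seq ('I_n * 'I_n)) (G : 'I_n * 'I_n -> X -> X -> rat) h i a :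
  i \notin pair_word s ->
  \prod_(p <- s) G p (upd h i a p.1) (upd h i a p.2) = \prod_(p <- s) G p (h p.1) (h p.2).
Proof.
elim: s => [|p s IH]; first by rewrite !big_nil.
rewrite pair_word_cons !inE !negb_or => /and3P[n1 n2 /IH E].
by rewrite !big_cons E !upd_neq // eq_sym.
Qed.

(** Each pair has its two slots summed by [sum_upd2], at the cost of [#|X| ^ 2], and contributes one
    factor. *)
Lemma sum_prod_pairs (s : seq ('I_n * 'I_n)) (G : 'I_n * 'I_n -> X -> X -> rat) :
  uniq (pair_word s) ->
  #|X|%:R ^+ (2 * size s) * \sum_(h : {ffun 'I_n -> X}) \prod_(p <- s) G p (h p.1) (h p.2)
    = #|X|%:R ^+ n * \prod_(p <- s) \sum_a \sum_b G p a b.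
Proof.
elim: s => [|p s IH].
  move=> _; rewrite big_nil mul1r mulr1.
  under eq_bigr do rewrite big_nil.
  by rewrite sumr_const card_ffun card_ord -natrX.
rewrite pair_word_cons /= inE negb_or => /and3P[/andP[n12 n1] n2 us].
rewrite mulnS addnC exprD -mulrA -(sum_upd2 _ p.1 p.2) big_cons [in RHS]mulrCA -IH //.
rewrite [in RHS]mulrCA; congr (_ * _).
rewrite mulr_sumr; apply: eq_bigr => h _; rewrite mulr_suml.
apply: eq_bigr => a _; rewrite mulr_suml; apply: eq_bigr => b _.
by rewrite big_cons upd_same upd_neq // upd_same !prod_upd.
Qed.

Lemma sum_prod_pairs_full (s : seq ('I_n * 'I_n)) (G : 'I_n * 'I_n -> X -> X -> rat) :
  (0 < #|X|)%N -> uniq (pair_word s) -> size (pair_word s) = n ->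
  \sum_(h : {ffun 'I_n -> X}) \prod_(p <- s) G p (h p.1) (h p.2)
    = \prod_(p <- s) \sum_a \sum_b G p a b.
Proof.
move=> X0 us sz; have := sum_prod_pairs G us; rewrite -size_pair_word sz.
by apply: mulfI; rewrite expf_neq0 // pnatr_eq0 -lt0n.
Qed.

End Update.

Lemma eq_prod_pairs (n : nat) (X : Type) (s : seq ('I_n * 'I_n)) (om : X -> X -> rat)
    (f f' : 'I_n -> X) : {in pair_word s, f =1 f'} ->
  \prod_(p <- s) om (f p.1) (f p.2) = \prod_(p <- s) om (f' p.1) (f' p.2).
Proof.
elim: s => [|p s IH] E; first by rewrite !big_nil.
rewrite !big_cons; rewrite pair_word_cons in E.
by rewrite !E ?inE ?eqxx ?orbT // IH // => i si; rewrite E // !inE si !orbT.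
Qed.

Section Gram.
Variables (k : nat) (X : finType) (om : X -> X -> rat).
Hypothesis X_gt0 : (0 < #|X|)%N.
Hypothesis om_alt : forall a b, om a b = - om b a.
Hypothesis om_orth : forall a b, \sum_c om a c * om b c = (a == b)%:R.
Implicit Types C D : chord k.
Local Notation N := (#|X|%:R : rat).

Lemma om_orth_l a b : \sum_c om c a * om c b = (a == b)%:R.
Proof.
by rewrite -om_orth; apply: eq_bigr => c _; rewrite [om c a]om_alt [om c b]om_alt mulrNN.
Qed.

Lemma sum_om_sqr : \sum_a \sum_b om a b * om a b = N.
Proof.
under eq_bigr do rewrite om_orth eqxx.
by rewrite sumr_const.
Qed.

Definition gram C D : rat :=
  \sum_(h : {ffun 'I_(2 * k) -> X}) chord_value om C h * chord_value om D h.

Lemma gram_same C : gram C C = N ^+ k.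
Proof.
transitivity (\sum_(h : {ffun 'I_(2 * k) -> X})
   \prod_(p <- chords C) (om (h p.1) (h p.2) * om (h p.1) (h p.2))).
  apply: eq_bigr => h _; rewrite /chord_value mulrACA -expr2 sgn_sqr mul1r.
  by rewrite big_split.
have [uC _] := represents_chords C; have sz := represents_size (represents_chords C).
rewrite (sum_prod_pairs_full (fun=> fun a b => om a b * om a b)) ?size_pair_word ?sz //.
by rewrite sum_om_sqr big_const_seq count_predT sz iter_mulr_1.
Qed.

(** In the union of [C] and [D] the vertices [j, i, a, b] form a path; after the exchange [i a] is a
    chord of both diagrams and [j b] is a chord of the new one. On summing over the labels at [i]
    and [a], orthogonality contracts the path to [om (h j) (h b)], while the double chord gives the
    sum of squares [N] times that factor. The sign is that of the transposition. *)
Lemma gram_split C D i (a := partner C i) (j := partner D i) : a != j ->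
  gram C (perm_chord (tperm j a) D) = - N * gram C D.
Proof.
move=> ne_aj; pose b := partner D a.
have ne_ai : a != i by apply: partner_neq.
have ne_ji : j != i by apply: partner_neq.
have ne_ba : b != a by apply: partner_neq.
have ne_bi : b != i by apply: contraNneq ne_aj => Eb; rewrite -(partnerK D a) -/b Eb.
have ne_bj : b != j.
  apply: contraNneq ne_ai => Eb.
  by rewrite -(partnerK D a) -/b Eb /j partnerK.
have [ne_ia ne_ij ne_ib] : [/\ i != a, i != j & i != b] by rewrite ![i == _]eq_sym.
have [ne_ja ne_jb ne_ab] : [/\ j != a, j != b & a != b].
  by rewrite ![j == _]eq_sym [a == b]eq_sym.
have [s1 rC] : exists s, represents ((i, a) :: s) C.
  apply: (represents_extend (t := [:: (i, a)])) => [|B].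
    by rewrite /pair_word /= inE ne_ia.
  by rewrite inE => /eqP->; apply: partnerP.
have [s2 rD] : exists s, represents [:: (i, j), (a, b) & s] D.
  apply: (represents_extend (t := [:: (i, j); (a, b)])) => [|B].
    by rewrite /pair_word /= !inE !negb_or ne_ij ne_ia ne_ib ne_ja ne_jb ne_ab.
  by rewrite !inE => /orP[]/eqP->; apply: partnerP.
have [uC _] := rC; have [uD _] := rD.
have [iC aC] : i \notin pair_word s1 /\ a \notin pair_word s1.
  by move: uC; rewrite pair_word_cons /= !inE !negb_or => /and3P[/andP[_ ->] ->].
have [iD jD aD] : [/\ i \notin pair_word s2, j \notin pair_word s2 & a \notin pair_word s2].
  move: uD; rewrite !pair_word_cons /= !inE !negb_or.
  by case/and5P=> /and4P[_ _ _ ->] /and3P[_ _ ->] /andP[_ ->].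
pose P1 (h : {ffun 'I_(2 * k) -> X}) := \prod_(p <- s1) om (h p.1) (h p.2).
pose P2 (h : {ffun 'I_(2 * k) -> X}) := \prod_(p <- s2) om (h p.1) (h p.2).
have P_upd h x y : P1 (upd (upd h i x) a y) * P2 (upd (upd h i x) a y) = P1 h * P2 h.
  by rewrite /P1 /P2 !(prod_upd (fun=> om)).
pose e := word_sign (pair_word ((i, a) :: s1))
  * word_sign (pair_word [:: (i, j), (a, b) & s2]).
have E1 : gram C D = e * \sum_(h : {ffun 'I_(2 * k) -> X})
    om (h i) (h a) * om (h i) (h j) * om (h a) (h b) * (P1 h * P2 h).
  rewrite mulr_sumr; apply: eq_bigr => h _.
  rewrite (chord_value_represents om_alt h rC) (chord_value_represents om_alt h rD).
  rewrite !big_cons -/(P1 h) -/(P2 h) mulrACA -/e; congr (_ * _).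
  by rewrite (mulrA (om (h i) (h j))) mulrACA; congr (_ * _); rewrite mulrA.
have E2 : gram C (perm_chord (tperm j a) D) = - e * \sum_(h : {ffun 'I_(2 * k) -> X})
    om (h i) (h a) * om (h i) (h a) * om (h j) (h b) * (P1 h * P2 h).
  rewrite mulr_sumr; apply: eq_bigr => h _.
  rewrite (chord_value_represents om_alt h rC) chord_value_perm //.
  rewrite (chord_value_represents om_alt (h \o _) rD) odd_tperm eq_sym ne_aj expr1.
  rewrite !big_cons (@eq_prod_pairs _ _ s2 _ _ h) => [|l s2l]; last first.
    by rewrite /= tpermD //; apply: contraTneq s2l => <-.
  rewrite -/(P1 h) -/(P2 h) /= tpermL tpermR !tpermD //; try by rewrite eq_sym.
  rewrite !mulN1r !mulrN mulNr; congr (- _); rewrite mulrACA -/e; congr (_ * _).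
  by rewrite (mulrA (om (h i) (h a))) mulrACA; congr (_ * _); rewrite mulrA.
(* Overwriting the labels at [i] and [a] multiplies both Gram entries by [N ^+ 2]. *)
have N0 : N ^+ 2 != 0 by rewrite expf_neq0 // pnatr_eq0 -lt0n.
have upd_i h x y : upd (upd h i x) a y i = x by rewrite upd_neq // upd_same.
have upd_j h x y : upd (upd h i x) a y j = h j by rewrite !upd_neq.
have upd_b h x y : upd (upd h i x) a y b = h b by rewrite !upd_neq.
pose T := \sum_(h : {ffun 'I_(2 * k) -> X}) om (h j) (h b) * (P1 h * P2 h).
have {}E1 : N ^+ 2 * gram C D = e * T.
  rewrite E1 mulrCA -(sum_upd2 _ i a); congr (_ * _); apply: eq_bigr => h _.
  under eq_bigr do under eq_bigr do rewrite P_upd upd_i upd_j upd_b upd_same.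
  rewrite exchange_big /=.
  under eq_bigr do rewrite -!mulr_suml om_orth_l.
  by rewrite -mulr_suml (bigD1 (h j)) //= eqxx mul1r big1 ?addr0 // => y /negbTE->;
    rewrite mul0r.
have {}E2 : N ^+ 2 * gram C (perm_chord (tperm j a) D) = - e * (N * T).
  rewrite E2 mulrCA -(sum_upd2 _ i a); congr (_ * _); rewrite mulr_sumr.
  apply: eq_bigr => h _; rewrite -sum_om_sqr mulr_suml; apply: eq_bigr => x _.
  rewrite mulr_suml; apply: eq_bigr => y _.
  by rewrite P_upd upd_i upd_j upd_b upd_same -!mulrA.
by apply: (mulfI N0); rewrite E2 [RHS]mulrCA E1 !mulNr mulrCA.
Qed.

End Gram.

(** * Connected components of the union of two diagrams *)

Section Components.
Variable k : nat.
Implicit Types C D : chord k.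

Definition union_rel C D : rel 'I_(2 * k) :=
  fun i j => (j == partner C i) || (j == partner D i).

Lemma union_rel_sym C D : connect_sym (union_rel C D).
Proof.
apply: sym_connect_sym => i j; rewrite /union_rel -!mem_partner.
by rewrite [[set j; i]]setUC.
Qed.

Lemma ncomp_unionE C D : ncomp_union C D = n_comp (union_rel C D) 'I_(2 * k).
Proof.
transitivity (n_comp (union_rel C D) [set: 'I_(2 * k)]); last first.
  by apply: eq_n_comp_r => i; rewrite inE.
apply: eq_n_comp; apply: eq_connect => i j.
by rewrite inE !mem_partner.
Qed.

(** The components are the orbits of [partner C], all of order two. *)
Lemma ncomp_union_same C : ncomp_union C C = k.
Proof.
rewrite ncomp_unionE; apply/eqP; rewrite -(eqn_pmul2r (m := 2)) //.
rewrite (@eq_n_comp _ _ (frel (partner C))) => [|i j]; last first.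
  by apply: eq_connect => {}i {}j; rewrite /union_rel orbb eq_sym.
rewrite fcard_order_set ?card_ord 1?mulnC //; first exact: inv_inj (@partnerK _ C).
apply/subsetP=> i _; rewrite inE.
rewrite (@order_cycle _ _ [:: i; partner C i]) ?inE ?eqxx //=.
  by rewrite partnerK !eqxx.
by rewrite inE eq_sym partner_neq.
Qed.

Section Split.
Variables (C D : chord k) (i : 'I_(2 * k)).
Let a := partner C i.
Let j := partner D i.
Let b := partner D a.
Let D' := perm_chord (tperm j a) D.
Hypothesis ne_aj : a != j.

Let Ca : partner C a = i. Proof. exact: partnerK. Qed.
Let Dj : partner D j = i. Proof. exact: partnerK. Qed.
Let Db : partner D b = a. Proof. exact: partnerK. Qed.

Let ne_ai : a != i. Proof. exact: partner_neq. Qed.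
Let ne_ji : j != i. Proof. exact: partner_neq. Qed.
Let ne_ba : b != a. Proof. exact: partner_neq. Qed.
Let ne_bi : b != i.
Proof. by apply: contraNneq ne_aj => Eb; rewrite -Db Eb. Qed.
Let ne_bj : b != j.
Proof. by apply: contraNneq ne_ai => Eb; rewrite -Db Eb Dj. Qed.

Lemma partner_split_i : partner D' i = a.
Proof. by rewrite -[i in LHS](@tpermD _ j a) // partner_perm tpermL. Qed.

Lemma partner_split_a : partner D' a = i.
Proof. by rewrite -[a in LHS](tpermL j a) partner_perm Dj tpermD. Qed.

Lemma partner_split_j : partner D' j = b.
Proof. by rewrite -[j in LHS](tpermR j a) partner_perm tpermD // eq_sym. Qed.

Lemma partner_split_b : partner D' b = j.
Proof.
by rewrite -[b in LHS](@tpermD _ j a) 1?eq_sym // partner_perm Db tpermR.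
Qed.

Lemma partner_split x : x != i -> x != a -> x != j -> x != b ->
  partner D' x = partner D x.
Proof.
move=> xi xa xj xb; rewrite -[x in LHS](@tpermD _ j a) 1?eq_sym // partner_perm tpermD //.
  by apply: contraNneq xi => E; rewrite -(partnerK D x) -E Dj.
by apply: contraNneq xb => E; rewrite -(partnerK D x) -E.
Qed.

(** The involutions of [C] and [D] disagree at each of [i], [a], [j], [b], and elsewhere [D'] agrees
    with [D]; at [i] the disagreement disappears. This is the decreasing measure for the computation
    of the Gram matrix. *)
Lemma partner_split_agree :
  (#|[set x | partner C x != partner D' x]| < #|[set x | partner C x != partner D x]|)%N.
Proof.
apply: proper_card; apply/properP; split.
  apply/subsetP=> x; rewrite !inE; apply: contra => /eqP E.
  have xi : x != i by apply: contraNneq ne_aj => xi; rewrite /a -xi E xi.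
  have xa : x != a by apply: contraNneq ne_bi => xa; rewrite /b -xa -E xa Ca.
  rewrite partner_split ?E //.
    by apply: contraNneq ne_aj => xj; rewrite /a -Dj -xj -E partnerK.
  by apply: contraNneq ne_bi => xb; rewrite -xb -(partnerK C x) E xb Db Ca.
by exists i; rewrite !inE ?partner_split_i ?eqxx.
Qed.

(* The map [f] retracts the graph of [C, D] onto the complement of the component
   [{i, a}] split off in the graph of [C, D']. *)
Lemma ncomp_union_split : ncomp_union C D' = (ncomp_union C D).+1.
Proof.
pose e1 := union_rel C D; pose e2 := union_rel C D'.
have sym1 := union_rel_sym C D : connect_sym e1.
have sym2 := union_rel_sym C D' : connect_sym e2.
pose A := [pred x | (x != i) && (x != a)].
have clA : closed e2 A.
  apply: (intro_closed sym2) => x y e2xy /andP[xi xa]; apply/andP.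
  case/orP: e2xy => /eqP ->; split.
  - by apply: contraNneq xa => E; rewrite /a -E partnerK.
  - by apply: contraNneq xi => E; rewrite -Ca -E partnerK.
  - by apply: contraNneq xa => E; rewrite -(partnerK D' x) E partner_split_i.
  - by apply: contraNneq xi => E; rewrite -(partnerK D' x) E partner_split_a.
have e1C x : connect e1 x (partner C x) by apply: connect1; rewrite /e1 /union_rel eqxx.
have e1D x : connect e1 x (partner D x) by apply: connect1; rewrite /e1 /union_rel eqxx orbT.
have e2C x : connect e2 x (partner C x) by apply: connect1; rewrite /e2 /union_rel eqxx.
have e2D x : connect e2 x (partner D' x) by apply: connect1; rewrite /e2 /union_rel eqxx orbT.
pose f x := if x == i then j else if x == a then b else x.
have fi : f i = j by rewrite /f eqxx.
have fa : f a = b by rewrite /f (negbTE ne_ai) eqxx.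
have fx x : x != i -> x != a -> f x = x by move=> /negbTE xi /negbTE xa; rewrite /f xi xa.
have e1f x : connect e1 x (f x).
  rewrite /f; case: eqP => [->|_]; first exact: e1D.
  by case: eqP => [->|_]; [exact: e1D | exact: connect0].
have jb : connect e1 j b.
  apply: connect_trans (connect_trans (e1D j) _) (e1D a).
  by rewrite Dj; apply: e1C.
(* Under [f] the edge [i a] becomes the new chord [j b], and the edges [i j] and [a b] collapse. *)
have e1e2 x y : connect e1 x y = connect e2 (f x) (f y).
  apply/idP/idP.
    case/connectP=> p e1p ->{y}; elim: p x e1p => [|y p IH] x /=.
      by rewrite connect0.
    case/andP=> e1xy /IH; apply: connect_trans => {IH}.
    have [Ex|xi] := eqVneq x i.
      subst x; case/orP: e1xy => /eqP->; rewrite -/a -/j fi ?fa.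
        by rewrite -partner_split_j.
      by rewrite fx ?connect0 // eq_sym.
    have [Ex|xa] := eqVneq x a.
      subst x; case/orP: e1xy => /eqP->; rewrite fa ?Ca ?fi.
        by rewrite -partner_split_b.
      by rewrite fx ?connect0.
    rewrite (fx x) //; have [yi|yi] := eqVneq y i.
      case/orP: e1xy => /eqP Ey.
        by case/eqP: xa; rewrite /a -yi Ey partnerK.
      by rewrite yi fi /j -yi Ey partnerK connect0.
    have [ya|ya] := eqVneq y a.
      case/orP: e1xy => /eqP Ey.
        by case/eqP: xi; rewrite -Ca -ya Ey partnerK.
      by rewrite ya fa /b -ya Ey partnerK connect0.
    rewrite fx //; case/orP: e1xy => /eqP Ey; first by rewrite Ey.
    rewrite Ey -(@partner_split x) //.
      by apply: contraNneq yi => xj; rewrite Ey xj Dj.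
    by apply: contraNneq ya => xb; rewrite Ey xb Db.
  move=> e2xy; apply: connect_trans (e1f x) _; rewrite sym1.
  apply: connect_trans (e1f y) _; rewrite sym1.
  apply: connect_sub e2xy => u v /orP[]/eqP->; first exact: e1C.
  have [->|ui] := eqVneq u i; first by rewrite partner_split_i; apply: e1C.
  have [->|ua] := eqVneq u a.
    by rewrite partner_split_a -Ca; apply: e1C.
  have [->|uj] := eqVneq u j; first by rewrite partner_split_j.
  have [->|ub] := eqVneq u b; first by rewrite partner_split_b sym1.
  by rewrite partner_split.
(* The complement of [A] is a single component; on [A] the components correspond through [f] to
   those of the old graph. *)
rewrite !ncomp_unionE (n_compC A) addnC -[RHS]add1n; congr addn.
  transitivity (n_comp e2 (connect e2 i)); last exact: n_comp_connect.
  apply: eq_n_comp_r => x.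
  rewrite !inE negb_and !negbK; apply/orP/idP => [[]/eqP->|].
  - exact: connect0.
  - exact: e2C.
  move=> ix; have := closed_connect clA ix; rewrite !inE eqxx /= => /esym/negbT.
  by rewrite negb_and !negbK => /orP.
rewrite (adjunction_n_comp f sym2 sym1 clA).
  apply: eq_n_comp_r => x; rewrite !inE /f.
  case: (eqVneq x i) => [_|xi]; first by rewrite ne_ji eq_sym.
  by case: (eqVneq x a) => [_|xa]; rewrite ?ne_bi ?ne_ba ?xi ?xa.
split=> [x /andP[xi xa]|x y _]; last exact: e1e2.
by exists x; rewrite fx ?connect0.
Qed.

End Split.

Section Pairing.
Variables (X : finType) (om : X -> X -> rat).
Hypothesis X_gt0 : (0 < #|X|)%N.
Hypothesis om_alt : forall a b, om a b = - om b a.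
Hypothesis om_orth : forall a b, \sum_c om a c * om b c = (a == b)%:R.

(** Induction on the number of vertices at which the involutions differ. The bound is proved along,
    because [k - ncomp_union C D] is a truncated subtraction and the sign must change at each
    step. *)
Lemma gram_ncomp C D : (ncomp_union C D <= k)%N /\
  gram om C D = (-1) ^+ (k - ncomp_union C D) * #|X|%:R ^+ ncomp_union C D.
Proof.
have [m] := ubnP #|[set x | partner C x != partner D x]|.
elim: m D => // m IH D lt_m.
have [i ne_i|E] := pickP (fun i => partner C i != partner D i); last first.
  have <- : C = D by apply: partner_inj => i; have := E i; case: eqP.
  by rewrite ncomp_union_same leqnn subnn mul1r (gram_same X_gt0 om_orth).
have lt_D' := leq_trans (partner_split_agree ne_i) lt_m.
have [] := IH _ lt_D'; rewrite (ncomp_union_split ne_i) => le_k.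
rewrite (gram_split X_gt0 om_alt om_orth ne_i) => E; split; first exact: ltnW.
have N0 : #|X|%:R != 0 :> rat by rewrite pnatr_eq0 -lt0n.
apply: (mulfI N0); apply: oppr_inj; rewrite -mulNr E exprS mulrCA -mulrN -mulNr.
by congr (_ * _); rewrite -(subnSK le_k) exprS mulN1r opprK.
Qed.

End Pairing.
End Components.

(** * Tensors invariant under the symplectic Lie algebra *)

Section InvariantTensors.
Variables (n : nat) (X : finType) (om : X -> X -> rat).
Hypothesis om_alt : forall a b, om a b = - om b a.
Hypothesis om_orth : forall a b, \sum_c om a c * om b c = (a == b)%:R.
Local Notation idx := {ffun 'I_n -> X}.
Implicit Types (F : idx -> rat) (h : idx) (R : {set 'I_n}) (a b c p q : X).

Definition slot_pairing F i p h := \sum_c om c p * F (upd h i c).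

(** The coefficient at [h] of the derivation induced on [F] by [u |-> om u q * e_p], restricted to
    the slots in [R]. *)
Definition sp_term R F p q h := \sum_(i in R) (h i == p)%:R * slot_pairing F i q h.

(* The elements [u |-> om u q * e_p + om u p * e_q] span the symplectic Lie
   algebra; [sp_invariant R F] says that they kill [F] when acting by derivations
   on the tensor positions in [R]. *)
Definition sp_invariant R F := forall p q h, sp_term R F p q h + sp_term R F q p h = 0.

Definition contract i j F h := \sum_a \sum_b om a b * F (upd (upd h i a) j b).

Lemma sum_delta (G : X -> rat) p : \sum_a (a == p)%:R * G a = G p.
Proof.
rewrite (bigD1 p) //= eqxx mul1r big1 ?addr0 // => a /negbTE->.
by rewrite mul0r.
Qed.

Lemma sum_delta_sym (G : X -> rat) p : \sum_a (p == a)%:R * G a = G p.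
Proof. by under eq_bigr do rewrite eq_sym; rewrite sum_delta. Qed.

(** The action on the other slots commutes with the contraction; the last sum collects the slots [i]
    and [j] and is skew in [p] and [q]. *)
Lemma contract_sp_term R F i j p q h : i != j -> i \in R -> j \in R ->
  contract i j (sp_term R F p q) h =
  sp_term (R :\ i :\ j) (contract i j F) p q h
  + \sum_a \sum_b (om p b * om a q + om a p * om b q) * F (upd (upd h i a) j b).
Proof.
move=> ne_ij Ri Rj; have Rj' : j \in R :\ i by rewrite !inE eq_sym ne_ij.
pose hh a b := upd (upd h i a) j b.
have E a b : sp_term R F p q (hh a b) =
   (a == p)%:R * (\sum_c om c q * F (hh c b))
   + ((b == p)%:R * (\sum_c om c q * F (hh a c))
   + \sum_(l in R :\ i :\ j) (h l == p)%:R * (\sum_c om c q * F (upd (hh a b) l c))).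
  rewrite /sp_term (big_setD1 i) //= (big_setD1 j) //=.
  congr (_ * _ + (_ * _ + _)).
  - by rewrite /hh upd_neq // upd_same.
  - by apply: eq_bigr => c _; rewrite /hh -updC // upd_upd updC // eq_sym.
  - by rewrite /hh upd_same.
  - by apply: eq_bigr => c _; rewrite /hh upd_upd.
  apply: eq_bigr => l; rewrite !inE => /and3P[lj li _].
  by rewrite /hh !upd_neq.
rewrite /contract.
under eq_bigr do under eq_bigr do rewrite -/(hh _ _) E 2!mulrDr.
under eq_bigr do rewrite !big_split.
rewrite !big_split /= addrA addrC; congr (_ + _).
  rewrite /sp_term /slot_pairing /contract.
  under eq_bigr do under eq_bigr do rewrite mulr_sumr.
  under eq_bigr do rewrite exchange_big.
  rewrite exchange_big /=; apply: eq_bigr => l; rewrite !inE => /and3P[lj li _].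
  rewrite mulr_sumr.
  under eq_bigr do under eq_bigr do rewrite mulrCA mulr_sumr mulr_sumr.
  under eq_bigr do rewrite exchange_big.
  rewrite exchange_big /=; apply: eq_bigr => c _.
  rewrite !mulr_sumr; apply: eq_bigr => a _.
  rewrite !mulr_sumr; apply: eq_bigr => b _.
  rewrite /hh [upd (upd (upd h i a) j b) l c]updC 1?eq_sym //
    [upd (upd h i a) l c]updC 1?eq_sym //.
  by congr (_ * _); rewrite mulrCA.
have -> : \sum_a \sum_b om a b * ((a == p)%:R * (\sum_c om c q * F (hh c b)))
   = \sum_a \sum_b om p b * om a q * F (hh a b).
  rewrite exchange_big [RHS]exchange_big /=; apply: eq_bigr => b _.
  under eq_bigr do rewrite mulrCA.
  by rewrite sum_delta mulr_sumr; apply: eq_bigr => c _; rewrite mulrA.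
have -> : \sum_a \sum_b om a b * ((b == p)%:R * (\sum_c om c q * F (hh a c)))
   = \sum_a \sum_b om a p * om b q * F (hh a b).
  apply: eq_bigr => a _.
  under eq_bigr do rewrite mulrCA.
  by rewrite sum_delta mulr_sumr; apply: eq_bigr => c _; rewrite mulrA.
rewrite -big_split; apply: eq_bigr => a _; rewrite -big_split; apply: eq_bigr => b _ /=.
by rewrite mulrDl.
Qed.

Lemma contract_invariant R F i j : i != j -> i \in R -> j \in R ->
  sp_invariant R F -> sp_invariant (R :\ i :\ j) (contract i j F).
Proof.
move=> ne_ij Ri Rj invF p q h.
have : contract i j (fun h => sp_term R F p q h + sp_term R F q p h) h = 0.
  by rewrite /contract big1 // => a _; rewrite big1 // => b _; rewrite invF mulr0.
have -> : contract i j (fun h => sp_term R F p q h + sp_term R F q p h) h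
   = contract i j (sp_term R F p q) h + contract i j (sp_term R F q p) h.
  rewrite /contract -big_split; apply: eq_bigr => a _; rewrite -big_split.
  by apply: eq_bigr => b _; rewrite mulrDr.
rewrite !contract_sp_term // addrACA => /eqP; rewrite addr_eq0 => /eqP->.
rewrite -big_split; apply/eqP; rewrite oppr_eq0; apply/eqP/big1 => a _.
rewrite -big_split; apply: big1 => b _ /=.
by rewrite (om_alt p b) (om_alt q b); ring.
Qed.

(* Up to the sign coming from [sp_term R F q p = - sp_term R F p q], the left hand
   side is a sum of squares. *)
Lemma sum_sp_term R F :
  {in R &, forall i j, i != j -> forall h, contract i j F h = 0} ->
  \sum_h \sum_p \sum_q sp_term R F p q h * sp_term R F q p h
    = #|R|%:R * \sum_h F h ^+ 2.
Proof.
move=> ctr0; pose B i j h := slot_pairing F i (h j) h * slot_pairing F j (h i) h.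
(* This allows cancelling the powers of [#|X|] introduced by overwriting: a slot in [R] and an index
   [h0] provide an element of [X]. *)
have N0 h0 : #|X|%:R != 0 :> rat \/ #|R| = 0%N.
  have [->|[i Ri]] := set_0Vmem R; [by right; rewrite cards0 | left].
  by rewrite pnatr_eq0 -lt0n; apply/card_gt0P; exists (h0 i).
have upd_slot i h a p : slot_pairing F i p (upd h i a) = slot_pairing F i p h.
  by apply: eq_bigr => c _; rewrite upd_upd.
transitivity (\sum_h \sum_(i in R) \sum_(j in R) B i j h).
  apply: eq_bigr => h _.
  under eq_bigr do under eq_bigr do rewrite mulr_suml.
  under eq_bigr do rewrite exchange_big.
  rewrite exchange_big; apply: eq_bigr => i Ri /=.
  under eq_bigr do under eq_bigr do rewrite mulr_sumr.
  under eq_bigr do rewrite exchange_big.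
  rewrite exchange_big; apply: eq_bigr => j Rj /=.
  transitivity (\sum_p (h i == p)%:R * (\sum_q (h j == q)%:R
       * (slot_pairing F i q h * slot_pairing F j p h))).
    by apply: eq_bigr => p _; rewrite mulr_sumr; apply: eq_bigr => q _; ring.
  by rewrite sum_delta_sym sum_delta_sym.
rewrite exchange_big /= -sum1_card natr_sum mulr_suml; apply: eq_bigr => i Ri.
(* The diagonal terms [j = i] give [F h ^+ 2] by [om_orth]. The others, summed over the labels at
   [i] and [j], contain the factor [contract i j F h]. *)
rewrite exchange_big /= (bigD1 i) //= mul1r [X in _ + X]big1 => [|j /andP[Rj ne_ji]].
  rewrite addr0; have [h0 _|idx0] := pickP (predT : pred idx); last first.
    by rewrite !big1 // => h _; have := idx0 h.
  have [Nn0|R0] := N0 h0; last by have := cards0_eq R0 => R00; rewrite R00 inE in Ri.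
  apply: (mulfI Nn0); rewrite -!(sum_upd _ i); apply: eq_bigr => h _.
  rewrite /B; under eq_bigr do rewrite upd_same upd_slot.
  rewrite /slot_pairing; under eq_bigr do rewrite mulr_suml.
  rewrite exchange_big /=; apply: eq_bigr => c _.
  under eq_bigr do rewrite mulr_sumr.
  rewrite exchange_big /=.
  transitivity (\sum_d (c == d)%:R * (F (upd h i c) * F (upd h i d))).
    apply: eq_bigr => d _; rewrite -om_orth mulr_suml.
    by apply: eq_bigr => a _; ring.
  by rewrite sum_delta_sym expr2.
have [h0 _|idx0] := pickP (predT : pred idx); last first.
  by rewrite big1 // => h _; have := idx0 h.
have [Nn0|R0] := N0 h0; last by have := cards0_eq R0 => R00; rewrite R00 inE in Ri.
apply: (mulfI (expf_neq0 2 Nn0)); rewrite mulr0 -(sum_upd2 _ i j) big1 // => h _.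
have ne_ij : i != j by rewrite eq_sym.
transitivity (\sum_a (\sum_b slot_pairing F i b (upd h j b))
                      * slot_pairing F j a (upd h i a)).
  apply: eq_bigr => a _; rewrite mulr_suml; apply: eq_bigr => b _.
  by rewrite /B upd_same upd_neq // upd_same upd_slot updC // upd_slot.
rewrite big1 // => a _; rewrite [X in X * _](_ : _ = 0) ?mul0r //.
transitivity (contract i j F h); last exact: ctr0.
rewrite /contract exchange_big /=.
by apply: eq_bigr => b _; apply: eq_bigr => c _; rewrite updC.
Qed.

Lemma invariant_contract0 R F : R != set0 -> sp_invariant R F ->
  {in R &, forall i j, i != j -> forall h, contract i j F h = 0} ->
  forall h, F h = 0.
Proof.
move=> R0 invF ctr0; have := sum_sp_term ctr0; set S := \sum_h F h ^+ 2 => E.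
have S_ge0 : 0 <= S by apply: sumr_ge0 => h _; rewrite sqr_ge0.
have le0 : #|R|%:R * S <= 0.
  rewrite -E; apply: sumr_le0 => h _; apply: sumr_le0 => p _; apply: sumr_le0 => q _.
  have /eqP := invF p q h; rewrite addr_eq0 => /eqP->.
  by rewrite mulNr oppr_le0 -expr2 sqr_ge0.
have S0 : S = 0.
  apply: le_anti; rewrite S_ge0 andbT -(@pmulr_rle0 _ #|R|%:R) //.
  by rewrite ltr0n card_gt0.
move=> h; apply/eqP; rewrite -sqrf_eq0; move/eqP: S0.
by rewrite psumr_eq0 => [/allP/(_ h (mem_index_enum h))|i _]; rewrite ?sqr_ge0.
Qed.

Fixpoint contract_all (s : seq ('I_n * 'I_n)) F : idx -> rat :=
  if s is p :: s' then contract p.1 p.2 (contract_all s' F) else F.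

Lemma contract_all_invariant s F : uniq (pair_word s) ->
  sp_invariant setT F -> sp_invariant (~: [set i in pair_word s]) (contract_all s F).
Proof.
move=> + invF; elim: s => [_|p s IH].
  have -> : ~: [set i in pair_word [::]] = [set: 'I_n] by apply/setP=> i; rewrite !inE.
  exact: invF.
rewrite pair_word_cons /= inE negb_or => /and3P[/andP[n12 n1] n2 us].
have -> : ~: [set i in [:: p.1, p.2 & pair_word s]]
   = (~: [set i in pair_word s]) :\ p.1 :\ p.2.
  by apply/setP=> i; rewrite !inE !negb_or andbCA.
by apply: contract_invariant; rewrite ?inE //; apply: IH.
Qed.

Lemma contract_allE s F h : uniq (pair_word s) ->
  contract_all s F h =
    \sum_(h' : idx | [forall m, (m \in pair_word s) || (h' m == h m)])
      (\prod_(p <- s) om (h' p.1) (h' p.2)) * F h'.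
Proof.
elim: s h => [|[i j] s IH] h.
  rewrite (big_pred1 h) ?big_nil ?mul1r // => h'.
  apply/forallP/eqP => [E|-> m]; last by rewrite eqxx orbT.
  by apply/ffunP=> m; apply/eqP; have := E m.
rewrite pair_word_cons /= inE negb_or => /and3P[/andP[ne_ij n1] n2 us].
rewrite (partition_big (fun h' : idx => (h' i, h' j)) predT) //= /contract pair_bigA /=.
apply: eq_bigr => [[a b]] _ /=; rewrite IH // mulr_sumr; apply: eq_big => h'.
  apply/forallP/andP => [E|[/forallP E /eqP[Ei Ej]] m].
    have Ei : h' i = a by apply/eqP; have := E i; rewrite (negbTE n1) upd_neq // upd_same.
    have Ej : h' j = b by apply/eqP; have := E j; rewrite (negbTE n2) upd_same.
    split; last by rewrite Ei Ej.
    apply/forallP=> m; rewrite !inE; have [//|mi] := eqVneq m i.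
    by have [//|mj] := eqVneq m j; have := E m; rewrite !upd_neq.
  have [->|mj] := eqVneq m j; first by rewrite upd_same Ej eqxx orbT.
  have [->|mi] := eqVneq m i; first by rewrite upd_neq // upd_same Ei eqxx orbT.
  by rewrite !upd_neq //; have := E m; rewrite !inE (negbTE mi) (negbTE mj).
move=> /forallP E; rewrite big_cons /= mulrA; congr (_ * _ * _).
have /eqP-> : h' j == b by have := E j; rewrite (negbTE n2) upd_same.
by have /eqP-> : h' i == a by have := E i; rewrite (negbTE n1) upd_neq // upd_same.
Qed.

(** Downward induction on the number of slots covered by [s]: if contracting any two further slots
    gives zero, [invariant_contract0] applies to [contract_all s F] on the remaining slots. The
    empty list gives [F] itself. *)
Lemma invariant_full_contractions0 F : sp_invariant setT F ->
  (forall s, uniq (pair_word s) -> size (pair_word s) = n ->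
     \sum_(h : idx) (\prod_(p <- s) om (h p.1) (h p.2)) * F h = 0) ->
  forall h, F h = 0.
Proof.
move=> invF full0.
have full s : uniq (pair_word s) -> (n <= size (pair_word s))%N ->
    forall h, contract_all s F h = 0.
  move=> us le_n; have le_s : (size (pair_word s) <= n)%N.
    by rewrite -[n in (_ <= n)%N]card_ord -(card_uniqP us) max_card.
  have sz : size (pair_word s) = n by apply/eqP; rewrite eqn_leq le_s.
  move=> h; rewrite contract_allE //; apply: etrans (full0 s us sz); apply: eq_bigl => h'.
  by apply/forallP=> i; rewrite mem_pair_word_full.
suff main m s : uniq (pair_word s) -> (n - size (pair_word s) <= m)%N ->
    forall h, contract_all s F h = 0 by move=> h; apply: (main n [::]); rewrite ?leq_subr.
elim: m s => [|m IH] s us le_m.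
  by apply: full => //; rewrite -subn_eq0 -leqn0.
have [|lt_n] := leqP n (size (pair_word s)); first exact: full.
have invs := contract_all_invariant us invF.
apply: (invariant_contract0 _ invs) => [|i j].
  apply: contraTneq lt_n => /setP E; rewrite -leqNgt -[n in (n <= _)%N]card_ord.
  rewrite -(card_uniqP us); apply/subset_leq_card/subsetP=> i _.
  by have := E i; rewrite !inE => /negbT; rewrite negbK.
rewrite !inE => ni nj ne_ij h.
apply: (IH ((i, j) :: s)); first by rewrite pair_word_cons /= inE negb_or ne_ij ni nj us.
rewrite pair_word_cons /= leq_subLR; move: le_m; rewrite leq_subLR => /leq_trans; apply.
by rewrite addnS !addSn leqnSn.
Qed.

End InvariantTensors.

(** * The symplectic group *)

Section Polynomials.

Lemma coef0_prod (I : Type) (r : seq I) (p : I -> {poly rat}) :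
  (\prod_(i <- r) p i)`_0 = \prod_(i <- r) (p i)`_0.
Proof.
by apply: (big_morph (fun q : {poly rat} => q`_0)) => [q1 q2|]; rewrite ?coef0M ?coef1.
Qed.

(** The Leibniz rule at zero; it differentiates the action of a transvection on tensors. *)
Lemma coef1_prod_linear (I : eqType) (r : seq I) (a b : I -> rat) : uniq r ->
  (\prod_(i <- r) ((a i)%:P + b i *: 'X))`_1
    = \sum_(i <- r) b i * \prod_(j <- r | j != i) a j.
Proof.
elim: r => [|i r IH]; first by rewrite !big_nil coef1.
case/andP=> ni ur; rewrite !big_cons eqxx /= mulrDl coefD coefCM IH //.
rewrite -scalerAl coefZ coefXM coef0_prod addrC; congr (_ * _ + _).
  rewrite [RHS]big_seq_cond [LHS]big_seq; apply: eq_big => [j|j _].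
    by have [rj|//] := boolP (j \in r); apply/esym; apply: contraNneq ni => <-.
  by rewrite coefD coefC coefZ coefX mulr0 addr0.
rewrite mulr_sumr !big_seq; apply: eq_bigr => j rj.
rewrite big_cons ifT; last by apply: contraNneq ni => ->.
by rewrite mulrCA.
Qed.

Lemma poly_const_of_nat_values (p : {poly rat}) c :
  (forall t : nat, p.[t%:R] = c) -> p = c%:P.
Proof.
move=> pc; apply/eqP; rewrite -subr_eq0; apply/eqP; set q := p - _.
pose rs : seq rat := [seq t%:R | t <- iota 0 (size q)].
apply: (@roots_geq_poly_eq0 _ _ rs).
- by apply/allP=> _ /mapP[t _ ->]; rewrite /root !hornerE pc subrr.
- by rewrite map_inj_uniq ?iota_uniq // => s t /eqP; rewrite eqr_nat => /eqP.
by rewrite size_map size_iota.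
Qed.

End Polynomials.

Section Symplectic.
Variable g : nat.
Local Notation T := (sympl_idx g).
Local Notation om := (@omega0 g).
Implicit Types (u v w : symplH g) (a b c : T).

Lemma card_sympl_idx : #|T| = (2 * g)%N.
Proof. by rewrite card_sum card_ord addnn mul2n. Qed.

Lemma omega0E a b : om a b =
  match a, b with
  | inl i, inr j => (i == j)%:R
  | inr i, inl j => - (i == j)%:R
  | _, _ => 0
  end.
Proof.
rewrite /omega0; under eq_bigr do rewrite !ffunE.
case: a b => [i|i] [j|j] /=.
- by rewrite big1 // => l _; rewrite mulr0 mul0r subr0.
- under eq_bigr do rewrite mul0r subr0.
  by rewrite eq_sym; exact: (sum_delta_sym (fun l => (j == l)%:R)).
- under eq_bigr do rewrite mul0r sub0r.
  by rewrite sumrN eq_sym; congr (- _); exact: (sum_delta_sym (fun l => (j == l)%:R)).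
by rewrite big1 // => l _; rewrite mulr0 mul0r subr0.
Qed.

Lemma omega0_alt a b : om a b = - om b a.
Proof. by rewrite !omega0E; case: a b => [i|i] [j|j]; rewrite ?oppr0 ?opprK // eq_sym. Qed.

Lemma omega0_orth a b : \sum_c om a c * om b c = (a == b)%:R.
Proof.
rewrite big_sumType /=; under eq_bigr do rewrite !omega0E.
under [X in _ + X]eq_bigr do rewrite !omega0E.
case: a b => [i|i] [j|j] /=.
- rewrite big1 ?add0r => [|l _]; last by rewrite mul0r.
  by rewrite (sum_delta_sym (fun l => (j == l)%:R)) eq_sym.
- by rewrite !big1 ?add0r // => l _; rewrite ?mul0r ?mulr0.
- by rewrite !big1 ?add0r // => l _; rewrite ?mul0r ?mulr0.
rewrite addrC big1 ?add0r => [|l _]; last by rewrite mul0r.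
under eq_bigr do rewrite mulrNN.
by rewrite (sum_delta_sym (fun l => (j == l)%:R)) eq_sym.
Qed.

Lemma mu_basis a b : mu (basis_vec a) (basis_vec b) = om a b.
Proof.
by apply: eq_bigr => i _; rewrite !ffunE ![inl i == _]eq_sym ![inr i == _]eq_sym.
Qed.

Lemma muDl u v w : mu (u + v) w = mu u w + mu v w.
Proof. by rewrite /mu -big_split; apply: eq_bigr => i _; rewrite !ffunE /=; ring. Qed.

Lemma mu_alt u v : mu u v = - mu v u.
Proof. by rewrite /mu -sumrN; apply: eq_bigr => i _; ring. Qed.

Lemma muDr u v w : mu u (v + w) = mu u v + mu u w.
Proof. by rewrite mu_alt muDl opprD -!mu_alt. Qed.

Lemma muZl (x : rat) u v : mu (x *: u) v = x * mu u v.
Proof.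
rewrite /mu mulr_sumr; apply: eq_bigr => i _; rewrite !ffunE.
rewrite -[_ *: u (inl i)]/(_ * _) -[_ *: u (inr i)]/(_ * _); ring.
Qed.

Lemma muZr (x : rat) u v : mu u (x *: v) = x * mu u v.
Proof. by rewrite mu_alt muZl -mulrN -mu_alt. Qed.

Lemma mu_diag u : mu u u = 0.
Proof. by rewrite /mu big1 // => i _; ring. Qed.

Lemma muE u v : mu u v = \sum_a \sum_b (u a : rat) * (v b : rat) * om a b.
Proof.
have mu_sumr (I : finType) (G : I -> symplH g) w : mu w (\sum_i G i) = \sum_i mu w (G i).
  apply: (big_morph (mu w)) => [x y|]; first exact: muDr.
  by rewrite -(scale0r 0) muZr mul0r.
rewrite [in LHS](basis_decomp u) mu_alt mu_sumr -sumrN; apply: eq_bigr => a _.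
rewrite [in LHS](basis_decomp v) -mu_alt mu_sumr; apply: eq_bigr => b _.
by rewrite muZl muZr mu_basis mulrA.
Qed.

(* A symplectic [A] satisfies [A^T W A = W]; as [W W^T = 1], also [A W A^T = W]. *)
Lemma symplectic_omega0 (A : 'End(symplH g)) : Defs.is_symplectic A -> forall c d,
  \sum_a \sum_b om a b * ((A (basis_vec a) c : rat) * (A (basis_vec b) d : rat)) = om c d.
Proof.
move=> spA c d.
pose W : 'M[rat]_#|T| := \matrix_(i, j) om (enum_val i) (enum_val j).
pose M : 'M[rat]_#|T| := \matrix_(i, j) (A (basis_vec (enum_val j)) (enum_val i) : rat).
have sumT (G : T -> rat) : \sum_(i < #|T|) G (enum_val i) = \sum_a G a.
  by rewrite [RHS](reindex (@enum_val T T)) //; apply: onW_bij; apply: enum_val_bij.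
have WWt : W *m W^T = 1%:M.
  apply/matrixP=> i j; rewrite !mxE -(inj_eq enum_val_inj) -omega0_orth -sumT.
  by apply: eq_bigr => l _; rewrite !mxE.
have MtWM : M^T *m W *m M = W.
  apply/matrixP=> i j; rewrite mxE [RHS]mxE -mu_basis -spA muE exchange_big /= -sumT.
  apply: eq_bigr => l _; rewrite mxE -sumT mulr_suml; apply: eq_bigr => m _.
  by rewrite !mxE; ring.
have E : M *m W^T *m M^T = W^T.
  have : (W^T *m M^T *m W) *m M = 1%:M.
    by rewrite -!mulmxA [M^T *m _]mulmxA MtWM; apply: mulmx1C.
  move/mulmx1C; rewrite !mulmxA => MWtMtW.
  by rewrite -[LHS]mulmx1 -WWt mulmxA MWtMtW mul1mx.
rewrite [RHS]omega0_alt.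
have /matrixP/(_ (enum_rank c) (enum_rank d)) := E; rewrite !mxE !enum_rankK => <-.
rewrite exchange_big -sumT -sumrN; apply: eq_bigr => l _ /=.
rewrite mxE -sumT mulr_suml -sumrN; apply: eq_bigr => m _.
by rewrite !mxE !enum_rankK omega0_alt; ring.
Qed.

Lemma tensor_powE n (A : 'End(symplH g)) (xi : tensor g n) (h : multi_idx g n) :
  tensor_pow n A xi h
    = \sum_(l : multi_idx g n) (xi l : rat) * \prod_i (A (basis_vec (l i)) (h i) : rat).
Proof. by rewrite lin_ext_coef; apply: eq_bigr => l _; rewrite ffunE. Qed.

Definition transvection v (t : rat) : 'End(symplH g) :=
  lin_ext (fun a => basis_vec a + (t * mu (basis_vec a) v) *: v).

Lemma transvectionE v t u : transvection v t u = u + (t * mu u v) *: v.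
Proof.
rewrite lin_extE; under eq_bigr do rewrite scalerDr scalerA.
rewrite big_split /= -basis_decomp -scaler_suml; congr (_ + _ *: _).
rewrite [in RHS](basis_decomp u).
rewrite (big_morph (fun w => mu w v) (id1 := 0) (op1 := +%R)); first 1 last.
- by move=> w1 w2; rewrite muDl.
- by rewrite -(scale0r 0) muZl mul0r.
by rewrite mulr_sumr; apply: eq_bigr => a _; rewrite muZl; ring.
Qed.

Lemma transvection_symplectic v t : Defs.is_symplectic (transvection v t).
Proof.
move=> u w; rewrite !transvectionE !(muDl, muDr, muZl, muZr) mu_diag (mu_alt v w).
by ring.
Qed.

Section LieInvariance.
Variables (n : nat) (xi : tensor g n).
Hypothesis xi_inv : Sp_invariant xi.

(** Each coefficient of the transformed tensor is a polynomial in [t] with the constant value [xi h]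
    on the natural numbers, so its linear coefficient vanishes: this is the derivative at [t = 0]
    along the transvections in direction [v]. *)
Lemma transvection_derivative v (h : multi_idx g n) :
  \sum_i \sum_c mu (basis_vec c) v * (v (h i) : rat) * (xi (upd h i c) : rat) = 0.
Proof.
(* The entry of the transvection in row [h i] and column [l i] is [a l i + t * b l i]. *)
pose a (l : multi_idx g n) i : rat := (h i == l i)%:R.
pose b (l : multi_idx g n) i : rat := mu (basis_vec (l i)) v * (v (h i) : rat).
pose P := \sum_(l : multi_idx g n) (xi l : rat) *: \prod_i ((a l i)%:P + b l i *: 'X).
have Pc (t : nat) : P.[t%:R] = xi h.
  rewrite -[in RHS](xi_inv (transvection_symplectic v t%:R)) tensor_powE horner_sum.
  apply: eq_bigr => l _; rewrite hornerZ horner_prod; congr (_ * _).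
  apply: eq_bigr => i _; rewrite !hornerE transvectionE !ffunE.
  by rewrite -[_ *: v (h i)]/(_ * _) /a /b; ring.
have := congr1 (fun p : {poly rat} => p`_1) (poly_const_of_nat_values Pc).
rewrite coefC coef_sum /= => P1; apply: etrans P1.
under [RHS]eq_bigr do rewrite coefZ coef1_prod_linear ?index_enum_uniq // mulr_sumr.
rewrite [RHS]exchange_big; apply: eq_bigr => i _ /=.
(* Only the indices [l] that agree with [h] outside slot [i] contribute; they are the
   [upd h i c]. *)
rewrite (bigID (fun l : multi_idx g n => [forall j, (j != i) ==> (h j == l j)])) /=.
rewrite [X in _ = _ + X]big1 ?addr0 => [|l /forallPn[j]]; last first.
  rewrite negb_imply => /andP[ji nhl].
  by rewrite (bigD1 j) //= /a (negbTE nhl) mul0r !mulr0.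
rewrite (reindex_onto (fun c => upd h i c) (fun l : multi_idx g n => l i)); last first.
  move=> l /forallP hl; apply/ffunP=> j; rewrite ffunE; case: eqP => [->//|/eqP ji].
  by have /implyP/(_ ji)/eqP := hl j.
apply: eq_big => [c|c _].
  rewrite upd_same eqxx andbT; apply/esym/forallP=> j; apply/implyP=> ji.
  by rewrite upd_neq.
rewrite big1 => [|j ji]; last by rewrite /a upd_neq ?eqxx.
by rewrite mulr1 /b upd_same mulrC.
Qed.

(** Polarization: [D] is biadditive and vanishes on the diagonal, and its values on basis vectors
    are the terms [sp_term]. *)
Lemma Sp_invariant_lie : sp_invariant om setT (fun h => xi h : rat).
Proof.
move=> p q h.
pose D u v := \sum_i \sum_c mu (basis_vec c) u * (v (h i) : rat) * (xi (upd h i c) : rat).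
have DD u v : D (u + v) (u + v) = D u u + D v v + (D u v + D v u).
  rewrite /D -!big_split; apply: eq_bigr => i _; rewrite -!big_split.
  by apply: eq_bigr => c _; rewrite muDr !ffunE /=; ring.
have Dpq a b : D (basis_vec a) (basis_vec b) = sp_term om setT (fun h => xi h : rat) b a h.
  rewrite /sp_term; apply: eq_big => [i|i _]; first by rewrite inE.
  rewrite mulr_sumr; apply: eq_bigr => c _; rewrite mu_basis ffunE.
  by ring.
have := DD (basis_vec p) (basis_vec q).
by rewrite /D !transvection_derivative -!/(D _ _) !add0r !Dpq addrC => <-.
Qed.

End LieInvariance.
End Symplectic.

(** * The maps between diagrams and tensors *)

Section Maps.
Variables g k : nat.
Local Notation om := (@omega0 g).
Local Notation idx := (multi_idx g (2 * k)).
Implicit Types (C D : chord k) (v : Q[chord k]) (xi : tensor g (2 * k)) (h : idx).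

Lemma chord_tensorE C h : chord_tensor g C h = chord_value om C h.
Proof. by rewrite !ffunE. Qed.

Lemma Phi_mapE v h : Phi_map g k v h = \sum_C (v C : rat) * chord_value om C h.
Proof. by rewrite lin_ext_coef; apply: eq_bigr => C _; rewrite chord_tensorE. Qed.

Lemma K_mapE xi C : K_map g k xi C = \sum_h (xi h : rat) * chord_value om C h.
Proof.
rewrite lin_ext_coef; apply: eq_bigr => h _; congr (_ * _).
rewrite sum_basisE.
by congr (_ * _); apply: eq_bigr => p _; rewrite mu_basis.
Qed.

Lemma dot_Phi_map v xi : dot (Phi_map g k v) xi = dot v (K_map g k xi).
Proof.
rewrite /dot; under eq_bigr do rewrite Phi_mapE mulr_suml.
under [RHS]eq_bigr do rewrite K_mapE mulr_sumr.
rewrite exchange_big; apply: eq_bigr => C _; apply: eq_bigr => h _ /=.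
by ring.
Qed.

Lemma prod_pair_word n (s : seq ('I_n * 'I_n)) (G : 'I_n -> rat) :
  uniq (pair_word s) -> size (pair_word s) = n ->
  \prod_i G i = \prod_(p <- s) (G p.1 * G p.2).
Proof.
move=> us sz; transitivity (\prod_(i <- pair_word s) G i).
  rewrite -[LHS]big_enum; apply: perm_big; apply: uniq_perm => //; first exact: enum_uniq.
  by move=> i; rewrite mem_pair_word_full ?mem_enum.
elim: s {us sz} => [|p s IH]; first by rewrite !big_nil.
by rewrite pair_word_cons !big_cons IH mulrA.
Qed.

(** Once the slots are grouped along the chords the sum factors, and each factor is a coefficient of
    [omega_0] again by [symplectic_omega0]. *)
Lemma Phi_map_invariant v : (0 < g)%N -> Sp_invariant (Phi_map g k v).
Proof.
move=> g0 A spA; apply/ffunP=> h; rewrite tensor_powE.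
under eq_bigr do rewrite Phi_mapE mulr_suml.
rewrite exchange_big Phi_mapE; apply: eq_bigr => C _ /=.
under eq_bigr do rewrite -mulrA.
rewrite -mulr_sumr; congr (_ * _); rewrite /chord_value.
have [uC _] := represents_chords C.
have szC : size (pair_word (chords C)) = (2 * k)%N := size_chord_word C.
pose G p a b := om a b * ((A (basis_vec a) (h p.1) : rat) * (A (basis_vec b) (h p.2) : rat)).
transitivity (sgn C * \sum_(l : idx) \prod_(p <- chords C) G p (l p.1) (l p.2)).
  rewrite mulr_sumr; apply: eq_bigr => l _; apply: etrans (esym (mulrA _ _ _)) _.
  by rewrite (prod_pair_word (fun i => (A (basis_vec (l i)) (h i) : rat)) uC szC) -big_split.
congr (_ * _).
rewrite sum_prod_pairs_full // ?card_sympl_idx ?muln_gt0 //.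
by apply: eq_bigr => p _; rewrite /G symplectic_omega0.
Qed.

Lemma K_Phi_map : (0 < g)%N -> (K_map g k \o Phi_map g k)%VF = M_map g k.
Proof.
move=> g0; apply/lfunP=> v; rewrite comp_lfunE (basis_decomp v) !linear_sum.
apply: eq_bigr => C _; rewrite !linearZ; congr (_ *: _).
rewrite /= /M_map /Phi_map !lin_ext_basis.
apply/ffunP=> D; rewrite K_mapE sum_basisE.
have X_gt0 : (0 < #|sympl_idx g|)%N by rewrite card_sympl_idx muln_gt0.
have [_] := gram_ncomp X_gt0 (@omega0_alt g) (@omega0_orth g) C D.
rewrite card_sympl_idx => E; apply: etrans E; apply: eq_bigr => h _; congr (_ * _).
by rewrite chord_tensorE.
Qed.

Lemma exists_chord (s : seq ('I_(2 * k) * 'I_(2 * k))) :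
  uniq (pair_word s) -> size (pair_word s) = (2 * k)%N -> exists C, represents s C.
Proof.
move=> us sz; pose P := [set B in pair_sets s].
have full i : i \in pair_word s by apply: mem_pair_word_full.
have share p q i : p \in s -> q \in s -> i \in [set p.1; p.2] -> i \in [set q.1; q.2] -> p = q.
  elim: (s) (us) => // r t IH; rewrite pair_word_cons /= inE negb_or.
  case/and3P=> /andP[_ nr1] nr2 ut; rewrite !in_cons.
  have nin r' : r' \in t -> i \in [set r.1; r.2] -> i \in [set r'.1; r'.2] -> False.
    move=> tr' ir ir'; have : i \in pair_word t
      by rewrite mem_pair_word; apply/hasP; exists r'.
    by move: ir; rewrite !inE => /orP[]/eqP->; [rewrite (negbTE nr1)|rewrite (negbTE nr2)].
  case/predU1P=> [->|tp] /predU1P[->|tq] ip iq //; first by case: (nin q).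
    by case: (nin p).
  exact: IH.
have neq p : p \in s -> p.1 != p.2.
  elim: (s) (us) => // r t IH; rewrite pair_word_cons /= inE negb_or.
  by case/and3P=> /andP[ne _] _ ut; rewrite inE => /predU1P[->|] //; apply: IH.
have chP : is_chord_diagram P.
  apply/andP; split; last first.
    by apply/forall_inP=> B; rewrite inE => /mapP[p sp ->]; rewrite cards2 neq.
  apply/and3P; split.
  - apply/eqP/setP=> i; rewrite inE; have := full i; rewrite mem_pair_word => /hasP[p sp ip].
    by apply/bigcupP; exists [set p.1; p.2] => //; rewrite inE; apply/mapP; exists p.
  - apply/trivIsetP=> A B; rewrite !inE => /mapP[p sp ->] /mapP[q sq ->] ne.
    rewrite -setI_eq0; apply: contraNT ne => /set0Pn[i]; rewrite inE => /andP[ip iq].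
    by rewrite (share p q i).
  rewrite inE; apply/mapP=> [[p _ /setP/(_ p.1)]].
  by rewrite !inE eqxx.
by exists (Sub P chP); split=> // B; rewrite SubK inE.
Qed.

(** Up to a nonzero [word_sign], a full contraction of [xi] along [s] is the coefficient of [K xi]
    at the diagram represented by [s]. *)
Lemma K_map_inj0 xi : Sp_invariant xi -> K_map g k xi = 0 -> xi = 0.
Proof.
move=> xi_inv K0; apply/ffunP=> h; rewrite [RHS]ffunE.
apply: (invariant_full_contractions0 (@omega0_alt g) (@omega0_orth g)
  (Sp_invariant_lie xi_inv)).
move=> s us sz; have [C rC] := exists_chord us sz.
have ws0 : word_sign (pair_word s) != 0.
  by rewrite -sqrf_eq0 word_sign_sqr // oner_eq0.
apply: (mulfI ws0); rewrite mulr0 mulr_sumr.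
have /ffunP/(_ C) := K0; rewrite K_mapE [RHS]ffunE => E; apply: etrans E.
apply: eq_bigr => l _; rewrite (chord_value_represents (@omega0_alt g) l rC).
by ring.
Qed.

Lemma tensor_actE (u : 'S_(2 * k)) xi h :
  tensor_act g u xi h = xi ([ffun i => h (u i)] : idx).
Proof.
pose f (t : 'S_(2 * k)) (l : idx) : idx := [ffun i => l (t i)].
have fK t : cancel (f t) (f t^-1%g).
  by move=> l; apply/ffunP=> i; rewrite !ffunE permKV.
exact: (lin_ext_perm (f := f u^-1%g) (f' := f u)
  (fun l => etrans (congr1 (f^~ _) (esym (invgK u))) (fK _ l)) (fK u)).
Qed.

Lemma perm_chordK (u : 'S_(2 * k)) : cancel (perm_chord u) (perm_chord u^-1%g).
Proof.
move=> C; apply: partner_inj => i.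
by rewrite -[i in LHS](permK u) !partner_perm permK.
Qed.

Lemma perm_chordVK (u : 'S_(2 * k)) : cancel (perm_chord u^-1%g) (perm_chord u).
Proof. by move=> C; rewrite -{1}(invgK u) perm_chordK. Qed.

Lemma chord_actE (u : 'S_(2 * k)) v C :
  chord_act u v C = v (perm_chord u^-1%g C).
Proof. exact: (lin_ext_perm (perm_chordK u) (perm_chordVK u)). Qed.

Lemma chord_act_adj (u : 'S_(2 * k)) v v' :
  dot (chord_act u v) v' = dot v (chord_act u^-1%g v').
Proof. exact: (dot_lin_ext_perm (perm_chordK u) (perm_chordVK u)). Qed.

Lemma tensor_act_adj (u : 'S_(2 * k)) xi xi' :
  dot (tensor_act g u xi) xi' = dot xi (tensor_act g u^-1%g xi').
Proof.
rewrite /dot (reindex (fun l : idx => [ffun i => l (u^-1 i)%g] : idx)) /=; last first.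
  by exists (fun l : idx => [ffun i => l (u i)] : idx) => l _; apply/ffunP=> i;
    rewrite !ffunE ?permK ?permKV.
apply: eq_bigr => l _; rewrite !tensor_actE; congr (xi _ * _).
by apply/ffunP=> i; rewrite !ffunE permK.
Qed.

Lemma Phi_map_act (u : 'S_(2 * k)) v :
  Phi_map g k (chord_act u v) = sgn_act (@tensor_act g (2 * k)) u (Phi_map g k v).
Proof.
apply/ffunP=> h; rewrite sgn_actE ffunE tensor_actE !Phi_mapE -[RHS]/(_ * _).
rewrite mulr_sumr (reindex (perm_chord u)) /=; last first.
  by exists (perm_chord u^-1%g) => C _; rewrite ?perm_chordK ?perm_chordVK.
apply: eq_bigr => C _; rewrite chord_actE perm_chordK chord_value_perm; last first.
  exact: omega0_alt.
rewrite mulrCA; congr (_ * (_ * _)).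
by congr (_ * _); apply: eq_bigr => p _; rewrite !ffunE.
Qed.

(** Obtained from [Phi_map_act] by taking adjoints; [u] and its inverse have the same sign. *)
Lemma K_map_act (u : 'S_(2 * k)) xi :
  K_map g k (tensor_act g u xi) = sgn_act (@chord_act k) u (K_map g k xi).
Proof.
have dot_ext (I : finType) (x y : Q[I]) : (forall z, dot z x = dot z y) -> x = y.
  move=> E; apply/ffunP=> i; have := E (basis_vec i).
  by rewrite !(dotC (basis_vec i)) !dot_basis.
apply: dot_ext => v; rewrite -dot_Phi_map sgn_actE dotZr.
rewrite dotC tensor_act_adj dotC -[u in RHS]invgK -chord_act_adj -dot_Phi_map Phi_map_act.
by rewrite sgn_actE dotZl odd_permV mulrA -expr2 sqrr_sign mul1r.
Qed.

(* The test index gives the [s]-th chord of [C] the labels [x_s], [y_s]: only [C]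
   itself contributes to this coefficient. *)
Lemma Phi_map_inj v : (k <= g)%N -> Phi_map g k v = 0 -> v = 0.
Proof.
move=> le_kg Phi0; apply/ffunP=> C; rewrite ffunE.
(* [cp i] is the chord of [C] through [i], smaller end first; its position in [chords C] serves as
   the label. *)
pose cp (i : 'I_(2 * k)) := if (i < partner C i)%N then (i, partner C i) else (partner C i, i).
have cpC i : cp i \in chords C.
  rewrite mem_chords /cp; case: (ltngtP i (partner C i)) (partner_neq C i)
    => /= [lt_i _|gt_i _|/val_inj E].
  - by rewrite lt_i partnerP.
  - by rewrite gt_i setUC partnerP.
  by rewrite -E eqxx.
have cp_partner i : cp (partner C i) = cp i.
  rewrite /cp partnerK; case: (ltngtP i (partner C i)) (partner_neq C i) => // /val_inj E.
  by rewrite -E eqxx.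
have lt_lab i : (index (cp i) (chords C) < g)%N.
  apply: leq_trans le_kg.
  by rewrite -[X in (_ < X)%N](represents_size (represents_chords C)) index_mem.
pose lab i : 'I_g := Ordinal (lt_lab i).
have lab_inj i i' : lab i = lab i' -> i' != i -> i' = partner C i.
  move/(congr1 val) => /= E ne; have : cp i = cp i'.
    by rewrite -(nth_index (i, i) (cpC i)) E nth_index.
  have cpS l : [set (cp l).1; (cp l).2] = [set l; partner C l].
    by rewrite /cp; case: ifP => //; rewrite setUC.
  move=> Ecp; have : i' \in [set i; partner C i] by rewrite -cpS Ecp cpS set21.
  by rewrite !inE (negbTE ne) => /eqP.
pose h : idx := [ffun i : 'I_(2 * k) =>
  if (i < partner C i)%N then inl (lab i) : sympl_idx g else inr (lab i)].
have om_lab i j : om (h i) (h j) != 0 -> lab i = lab j.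
  by rewrite !ffunE omega0E; case: ifP => _; case: ifP => _;
    rewrite ?eqxx ?oppr_eq0 // pnatr_eq0 eqb0 negbK => /eqP.
(* If no factor vanishes, every chord of [D] joins equal labels and hence is a chord of [C]. *)
have W0 D : D != C -> chord_value om D h = 0.
  move=> ne_DC; apply/eqP; rewrite mulf_eq0 prodf_seq_eq0; apply/orP; right.
  apply: contraNT ne_DC => /hasPn /= nz; apply/eqP/partner_inj => i.
  have [_ ED] := represents_chords D; have := partnerP D i; rewrite ED => /mapP[p Dp Ep].
  have := nz p Dp => /om_lab/lab_inj E.
  apply/eqP; rewrite -mem_partner Ep mem_partner E // eq_sym.
  by move: Dp; rewrite mem_chords => /andP[lt_p _]; rewrite neq_ltn lt_p.
have WC : chord_value om C h != 0.
  rewrite mulf_neq0 ?signr_eq0 // prodf_seq_neq0; apply/allP=> p Cp /=.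
  have : p.2 = partner C p.1.
    by apply/eqP; rewrite -mem_partner; move: Cp; rewrite mem_chords => /andP[].
  move: Cp; rewrite mem_chords => /andP[lt_p _] E; rewrite !ffunE E partnerK -E lt_p.
  rewrite ltnNge (ltnW lt_p) /= omega0E.
  by have -> : lab p.2 = lab p.1;
    [apply: val_inj; rewrite /= E cp_partner | rewrite eqxx oner_eq0].
have /ffunP/(_ h) := Phi0; rewrite Phi_mapE ffunE (bigD1 C) //= big1 ?addr0 => [/eqP|D ne].
  by rewrite mulf_eq0 (negbTE WC) orbF => /eqP.
by rewrite W0 ?mulr0.
Qed.

End Maps.

(** * The irreducible decompositions *)

Section SignedModules.
Variables (n : nat).

Lemma submod_iso_sgn2 (V1 V2 : vectType rat) (act1 : 'S_n -> 'End(V1))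
    (act2 : 'S_n -> 'End(V2)) (W1 : {vspace V1}) (W2 : {vspace V2}) :
  submod_iso act1 W1 act2 W2 -> submod_iso (sgn_act act1) W1 (sgn_act act2) W2.
Proof.
case=> f [fW f_inj fact]; exists f; split=> // s v Wv.
by rewrite !sgn_actE linearZ /= fact.
Qed.

(** A twist by signs does not change which subspaces are stable. *)
Lemma irreducible_sgn (V : vectType rat) (act : 'S_n -> 'End(V)) (W : {vspace V}) :
  irreducible_submod (sgn_act act) W -> irreducible_submod act W.
Proof.
have st (Y : {vspace V}) : act_stable (sgn_act act) Y <-> act_stable act Y.
  split=> stY s v Yv; last by rewrite sgn_actE memvZ ?stY.
  by rewrite -sgn_actK sgn_actE memvZ ?stY.
by case=> stW W0 irrW; split=> // [|Y sYW stY]; [apply/st | apply: irrW => //; apply/st].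
Qed.

End SignedModules.

Section Decompositions.
Variables g k : nat.
Hypothesis g_gt0 : (0 < g)%N.
Local Notation Phi := (Phi_map g k).
Local Notation K := (K_map g k).

Lemma Sp_invariantB (xi xi' : tensor g (2 * k)) :
  Sp_invariant xi -> Sp_invariant xi' -> Sp_invariant (xi - xi').
Proof. by move=> inv inv' A spA; rewrite linearB /= inv ?inv'. Qed.

Lemma K_map_inj (xi xi' : tensor g (2 * k)) :
  Sp_invariant xi -> Sp_invariant xi' -> K xi = K xi' -> xi = xi'.
Proof.
move=> inv inv' E; apply/eqP; rewrite -subr_eq0; apply/eqP.
by apply: K_map_inj0; [apply: Sp_invariantB | rewrite linearB /= E subrr].
Qed.

Lemma M_map_bij : (k <= g)%N -> injective (M_map g k) /\ limg (M_map g k) = fullv.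
Proof.
move=> le_kg; suff ker0 : lker (M_map g k) == 0%VS.
  by split; [apply/lker0P | apply: lker0_limgf].
rewrite -subv0; apply/subvP=> v; rewrite memv_ker memv0 -K_Phi_map // comp_lfunE.
move/eqP/(K_map_inj0 (Phi_map_invariant v g_gt0))/(Phi_map_inj le_kg)->.
exact: eqxx.
Qed.

(** The surjectivity of [Phi] onto the invariants comes from that of [M]: for invariant [xi], [K xi]
    equals [K (Phi v)] for some [v], and [K] is injective on invariants. *)
Lemma stable_range_isos : (k <= g)%N ->
  [/\ iso_between (fun _ => True) (@Sp_invariant g (2 * k)) Phi,
      iso_between (fun _ => True) (fun _ => True) (M_map g k) &
      iso_between (@Sp_invariant g (2 * k)) (fun _ => True) K].
Proof.
move=> le_kg; have [Minj Mimg] := M_map_bij le_kg.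
have ME v : M_map g k v = K (Phi v) by rewrite -K_Phi_map // comp_lfunE.
have Monto w : exists v, M_map g k v = w.
  have /memv_imgP[v _ ->] : w \in limg (M_map g k) by rewrite Mimg memvf.
  by exists v.
split; split=> //.
- by move=> v _; apply: Phi_map_invariant.
- move=> u v _ _ E; apply/eqP; rewrite -subr_eq0; apply/eqP.
  by apply: Phi_map_inj le_kg _; rewrite linearB /= E subrr.
- move=> xi inv; have [v Ev] := Monto (K xi); exists v => //.
  by apply: K_map_inj => //; [apply: Phi_map_invariant | rewrite -ME].
- by move=> u v _ _; apply: Minj.
- by move=> w _; have [v <-] := Monto w; exists v.
- by move=> xi xi' inv inv'; apply: K_map_inj.
by move=> w _; have [v <-] := Monto w; exists (Phi v); [apply: Phi_map_invariant | rewrite ME].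
Qed.

Variable E : seq nat -> {vspace Q[chord k]}.
Hypothesis decE : E_decomposition E.

Lemma E_orthogonal la nu : is_part_of k la -> is_part_of k nu -> la <> nu ->
  orthogonal_subspaces (E la) (E nu).
Proof.
case: decE => irrE nisoE _ _ pla pnu ne; apply: (noniso_orthogonal (@chord_act_adj k)).
- by have [] := irrE la pla.
- by have [] := irrE nu pnu.
by move/(nisoE la nu pla pnu).
Qed.

Variable U : seq nat -> {vspace tensor g (2 * k)}.
Hypothesis decU : U_decomposition U.

Lemma U_invariant la xi :
  is_part_of k la -> (size la <= g)%N -> xi \in U la -> Sp_invariant xi.
Proof.
case: decU => _ _ _ invU _ pla le_g Uxi; apply/invU.
have [nu Enu] := young_rows pla; apply: subvP Uxi; rewrite -Enu.
by apply: (sumv_sup nu); rewrite ?Enu.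
Qed.

Lemma K_map_U la : is_part_of k la -> (size la <= g)%N ->
  (K @: U la)%VS = E (conj_part la).
Proof.
move=> pla le_g; have pla' := conj_part_of pla.
have [irrE nisoE _ fullE] := decE; have [irrU _ _ _ _] := decU.
have [irrUla isoUla] := irrU la pla le_g; have [irrEla isoEla] := irrE _ pla'.
have [stU Un0 _] := irrUla; have [stE _ _] := irrEla.
set X := (K @: U la)%VS.
have isoX : submod_iso (@tensor_act g (2 * k)) (U la) (sgn_act (@chord_act k)) X.
  exists K; split=> // [xi xi' Uxi Uxi'|s xi _]; last exact: K_map_act.
  by apply: K_map_inj; apply: U_invariant Uxi || apply: U_invariant Uxi'.
have irrX := irreducible_sgn (irreducible_iso irrUla isoX).
have [stX Xn0 _] := irrX.
have isoXE : submod_iso (@chord_act k) X (@chord_act k) (E (conj_part la)).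
  (* Stability of the Specht module, required to invert the twist, is transported from
     [E (conj_part la)]. *)
  have [stS _ _] := irreducible_iso irrEla isoEla.
  apply: submod_iso_trans (submod_iso_sgnr (submod_iso_sym stU isoX)) _.
  apply: submod_iso_trans (submod_iso_sgn2 isoUla) _.
  apply: submod_iso_trans (submod_iso_sym stS (specht_conj_twist pla)) _.
  exact: submod_iso_sym stE isoEla.
have [j0 Ej0] := young_rows pla'.
rewrite -Ej0.
apply: (isotypic_unique (act := @chord_act k) (P := predT)
  (W := fun j : young k => E (rows j))) => //.
- move=> j _ ne_j; apply: E_orthogonal; rewrite ?rows_part //.
  by move/rows_inj=> Ej; rewrite Ej eqxx in ne_j.
- by rewrite Ej0.
- by rewrite fullE subvf.
move=> j _ ne_j; have [irrj _] := irrE _ (rows_part j).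
apply: (noniso_orthogonal (@chord_act_adj k) irrj irrX) => isoj.
have := nisoE _ _ (rows_part j) pla' (submod_iso_trans isoj isoXE).
by rewrite -Ej0 => /rows_inj Ej; rewrite Ej eqxx in ne_j.
Qed.

Lemma Phi_map_E la : is_part_of k la -> U la = (Phi @: E (conj_part la))%VS.
Proof.
move=> pla; have [irrU nisoU _ invU U0] := decU.
have inv_sum v : Phi v \in (\sum_(nu : young k | (size (rows nu) <= g)%N) U (rows nu))%VS.
  by apply/invU/Phi_map_invariant.
have [le_g|lt_g] := leqP (size la) g; last first.
  rewrite U0 //; apply/esym/eqP; rewrite -subv0; apply/subvP=> _ /memv_imgP[v Ev ->].
  (* [Phi v] is paired with its own components: [K] sends the one in [U (rows nu)] into
     [E (conj_part (rows nu))], and [rows nu] differs from [la] by its height. *)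
  rewrite memv0; apply/eqP/dot_eq0; have [xi Uxi Exi] := memv_sumP (inv_sum v).
  rewrite {2}Exi dot_sumr big1 // => nu le_nu; rewrite dot_Phi_map.
  apply: (E_orthogonal (conj_part_of pla) (conj_part_of (rows_part nu))) => //.
    move/(conj_part_inj pla (rows_part nu)) => Ela.
    by rewrite Ela ltnNge le_nu in lt_g.
  by rewrite -K_map_U ?rows_part // memv_img ?Uxi.
(* Writing [E (conj_part la)] as the image of [U la] under [K] turns the claim into one about the
   endomorphism [Phi \o K]. *)
rewrite -K_map_U // -limg_comp; set X := (_ @: U la)%VS.
have [irrUla _] := irrU la pla le_g; have [stU Un0 _] := irrUla.
have isoX : submod_iso (@tensor_act g (2 * k)) (U la) (@tensor_act g (2 * k)) X.
  exists (Phi \o K)%VF; split=> // [xi xi' Uxi Uxi' E0|s xi _]; last first.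
    by rewrite !comp_lfunE K_map_act sgn_actE linearZ /= Phi_map_act sgn_actE
      scalerA -expr2 sqrr_sign scale1r.
  apply/eqP; rewrite -subr_eq0; apply/eqP; apply: K_map_inj0.
    by apply: U_invariant pla le_g _; apply: memvB.
  (* The squared norm of [K z] is the inner product of [Phi (K z)] with [z], so [Phi \o K] has the
     same kernel as [K]. *)
  apply: dot_eq0; rewrite -dot_Phi_map -(comp_lfunE Phi K) linearB /= E0 subrr.
  by rewrite dotC dot0r.
have irrX := irreducible_iso irrUla isoX; have [stX Xn0 _] := irrX.
have [j0 Ej0] := young_rows pla; rewrite -Ej0; apply/esym.
apply: (isotypic_unique (act := @tensor_act g (2 * k))
  (P := fun j : young k => (size (rows j) <= g)%N) (W := fun j : young k => U (rows j))) => //.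
- by rewrite Ej0.
- move=> j le_j ne_j; have [irrj _] := irrU _ (rows_part j) le_j; rewrite Ej0.
  apply: (noniso_orthogonal (@tensor_act_adj g k) irrj irrUla) => isoj.
  have := nisoU _ _ (rows_part j) pla le_j le_g isoj.
  by rewrite -Ej0 => /rows_inj Ej; rewrite Ej eqxx in ne_j.
- by rewrite Ej0.
- by apply/subvP=> _ /memv_imgP[xi _ ->]; rewrite comp_lfunE.
move=> j le_j ne_j; have [irrj _] := irrU _ (rows_part j) le_j.
apply: (noniso_orthogonal (@tensor_act_adj g k) irrj irrX) => isoj.
have := nisoU _ _ (rows_part j) pla le_j le_g
  (submod_iso_trans isoj (submod_iso_sym stU isoX)).
by rewrite -Ej0 => /rows_inj Ej; rewrite Ej eqxx in ne_j.
Qed.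

End Decompositions.

Unset Implicit Arguments.

Theorem theorem1p8 (g k : nat) (hg : (1 <= g)%N) (hk : (1 <= k)%N) :
  [/\ forall v : Q[chord k], Sp_invariant (Phi_map g k v),
      (K_map g k \o Phi_map g k)%VF = M_map g k,
      (k <= g)%N ->
        [/\ iso_between (fun _ => True) (@Sp_invariant g (2 * k)) (Phi_map g k),
            iso_between (fun _ => True) (fun _ => True) (M_map g k) &
            iso_between (@Sp_invariant g (2 * k)) (fun _ => True) (K_map g k)] &
      forall E : seq nat -> {vspace Q[chord k]}, E_decomposition E ->
        (forall U : seq nat -> {vspace tensor g (2 * k)}, U_decomposition U ->
           (forall la, is_part_of k la ->
              U la = (Phi_map g k @: E (conj_part la))%VS)
           /\ (forall la, is_part_of k la -> (size la <= g)%N ->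
                 (K_map g k @: U la)%VS = E (conj_part la)))
        /\ (forall la nu, is_part_of k la -> is_part_of k nu -> la <> nu ->
              forall u v, u \in E (conj_part la) -> v \in E (conj_part nu) ->
                euclid u v = 0)].
Proof.
split=> [v|||E decE].
- exact: Phi_map_invariant.
- exact: K_Phi_map.
- exact: stable_range_isos.
split=> [U decU|la nu pla pnu ne].
  by split=> la pla; [apply: (Phi_map_E hg decE decU) | apply: (K_map_U decE decU)].
apply: (E_orthogonal decE (conj_part_of pla) (conj_part_of pnu)) => Econj.
exact/ne/(conj_part_inj pla pnu).
Qed.
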